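(* Let $(A,M)$ be a local ring and let $R=A\propto A/M$ be the trivial ring extension of $A$ by $A/M$. Then: (1) If $M$ is not finitely generated, then $R$ is a $G$-$(3,0)$-ring. (2) If $M$ contains a regular element, then $R$ is not a $G$-$(2,d)$-ring, for every integer $d\ge 0$. (3) Let $S$ be a Noetherian ring with $\mathrm{G\text{-}gldim}(S)=d$ for some integer $d\ge 0$. Then $T=R\times S$ is a $G$-$(3,d)$-ring which is neither a $G$-$(2,d)$-ring nor a $G$-$(3,d-1)$-ring.
   Context: All rings are commutative with identity and all modules are unital. ''$(A,M)$ local'' means that $A$ is a (not necessarily Noetherian) ring with unique maximal ideal $M$. A regular element is a non-zero-divisor. For a ring $A$ and an $A$-module $E$, the trivial ring extension $A\propto E$ is the ring with underlying group $A\times E$ and multiplication $(a,e)(a',e')=(aa',ae'+a'e)$. For a ring $R$, an $R$-module $N$ is Gorenstein projective if there is an exact sequence of projective modules $\mathbf P=\cdots\to P_1\to P_0\to P^0\to P^1\to\cdots$ with $N\cong \mathrm{Im}(P_0\to P^0)$ such that $\mathrm{Hom}_R(-,Q)$ leaves $\mathbf P$ exact for every projective module $Q$. The Gorenstein projective dimension $\mathrm{Gpd}_R(N)$ is the minimal length of a resolution of $N$ by Gorenstein projective modules ($\infty$ if there is no finite one), and $\mathrm{G\text{-}gldim}(R)=\sup\{\mathrm{Gpd}_R(N)\mid N \text{ an } R\text{-module}\}$. For an integer $n\ge 0$, an $R$-module $N$ is $n$-presented if there is an exact sequence $F_n\to F_{n-1}\to\cdots\to F_0\to N\to 0$ of $R$-modules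 with each $F_i$ a finitely generated free $R$-module. For integers $n,d\ge 0$, a ring $R$ is a $G$-$(n,d)$-ring if every $n$-presented $R$-module $N$ satisfies $\mathrm{Gpd}_R(N)\le d$.
   Formalization: Part (3) is stated assuming M is not finitely generated and contains a regular element; as written it fails for A=S a field, M=0, where T is a G-(2,0)-ring. For d=0, ''not a G-(3,d-1)-ring'' holds trivially, since no module has Gpd at most -1. *)

(* Defs.v *)
From HB Require Import structures.
From mathcomp Require Import all_boot all_order all_algebra.

Set Implicit Arguments.
Unset Strict Implicit.
Unset Printing Implicit Defensive.
Import Order.TTheory GRing.Theory Num.Theory.

Local Open Scope ring_scope.
Local Open Scope quotient_scope.

Section Ideals.
Variable R : comPzRingType.
Implicit Types I J : R -> Prop.

Definition is_ideal I : Prop :=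
  [/\ I 0, forall x y, I x -> I y -> I (x + y) & forall a x, I x -> I (a * x)].

Definition is_maximal_ideal I : Prop :=
  [/\ is_ideal I, ~ I 1 &
      forall J, is_ideal J -> ~ J 1 -> (forall x, I x -> J x) ->
        forall x, J x -> I x].

Definition fg_ideal I : Prop :=
  exists (n : nat) (g : 'I_n -> R),
    forall x, I x <-> exists c : 'I_n -> R, x = \sum_(i < n) c i * g i.

Definition noetherian : Prop := forall I, is_ideal I -> fg_ideal I.

End Ideals.

(* idealr A is the type of boolean predicates that are proper ideals, which is
   what the quotient construction of ring_quotient.v takes; uniqueness is
   required among all maximal ideals, not only the boolean ones. *)
Definition local_ring (A : comNzRingType) (M : idealr A) : Prop :=
  is_maximal_ideal (fun x => x \in M) /\
  forall J : A -> Prop, is_maximal_ideal J -> forall x, J x <-> x \in M.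

(* {ideal_quot M} is a ring in the library; it is made an A-module through the
   projection A -> A/M. *)
Section QuotientModule.
Variables (A : comNzRingType) (M : idealr A).

Definition quot_scale (a : A) (x : {ideal_quot M}) : {ideal_quot M} :=
  \pi_{ideal_quot M} a * x.

Lemma quot_scaleA a b x : quot_scale a (quot_scale b x) = quot_scale (a * b) x.
Proof. by rewrite /quot_scale rmorphM mulrA. Qed.

Lemma quot_scale1 : left_id 1 quot_scale.
Proof. by move=> x; rewrite /quot_scale rmorph1 mul1r. Qed.

Lemma quot_scaleDr : right_distributive quot_scale +%R.
Proof. by move=> a x y; rewrite /quot_scale mulrDr. Qed.

Lemma quot_scaleDl x : {morph quot_scale^~ x : a b / a + b}.
Proof. by move=> a b; rewrite /quot_scale rmorphD mulrDl. Qed.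

HB.instance Definition _ := GRing.Zmodule_isLmodule.Build A {ideal_quot M}
  quot_scaleA quot_scale1 quot_scaleDr quot_scaleDl.

End QuotientModule.

Definition trivial_ext (A : comPzRingType) (E : lmodType A) : Type :=
  (A * E)%type.

Section TrivialExtension.
Variables (A : comPzRingType) (E : lmodType A).
Local Notation T := (trivial_ext E).

HB.instance Definition _ := GRing.Zmodule.on T.

Definition trivial_ext_one : T := (1, 0).
Definition trivial_ext_mul (x y : T) : T :=
  (x.1 * y.1, x.1 *: y.2 + y.1 *: x.2).

Lemma trivial_ext_mulA : associative trivial_ext_mul.
Proof.
move=> [a e] [b f] [c g]; rewrite /trivial_ext_mul /= mulrA !scalerDr !scalerA.
by rewrite addrA (mulrC c a) (mulrC c b).
Qed.

Lemma trivial_ext_mulC : commutative trivial_ext_mul.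
Proof. by move=> [a e] [b f]; rewrite /trivial_ext_mul /= mulrC addrC. Qed.

Lemma trivial_ext_mul1 : left_id trivial_ext_one trivial_ext_mul.
Proof.
by move=> [a e]; rewrite /trivial_ext_mul /= mul1r scale1r scaler0 addr0.
Qed.

Lemma trivial_ext_mulDl : left_distributive trivial_ext_mul +%R.
Proof.
move=> [a e] [b f] [c g]; congr pair; rewrite /= ?mulrDl //.
by rewrite scalerDl scalerDr addrACA.
Qed.

HB.instance Definition _ := GRing.Zmodule_isComPzRing.Build T
  trivial_ext_mulA trivial_ext_mulC trivial_ext_mul1 trivial_ext_mulDl.

End TrivialExtension.

Section GorensteinProjective.
Variable R : comPzRingType.

Definition exact_at (U V W : lmodType R)
    (f : {linear U -> V}) (g : {linear V -> W}) : Prop :=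
  forall v, g v = 0 <-> exists u, f u = v.

Definition surj (U V : lmodType R) (f : {linear U -> V}) : Prop :=
  forall v, exists u, f u = v.

Definition projective (P : lmodType R) : Prop :=
  forall (U V : lmodType R) (g : {linear U -> V}) (f : {linear P -> V}),
    surj g -> exists h : {linear P -> U}, forall x, g (h x) = f x.

(* The sequence 'Hom(P3, Q) -> 'Hom(P2, Q) -> 'Hom(P1, Q) is exact. *)
Definition hom_exact (P1 P2 P3 : lmodType R)
    (f : {linear P1 -> P2}) (g : {linear P2 -> P3}) (Q : lmodType R) : Prop :=
  forall u : {linear P2 -> Q},
    (forall x, u (f x) = 0) <->
    exists w : {linear P3 -> Q}, forall x, w (g x) = u x.

(* The complex is indexed cohomologically by int: P 0, P (-1), P (-2), ... are
   the modules P_0, P_1, P_2, ... and P 1, P 2, ... are P^0, P^1, ..., so that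
   d 0 is the map P_0 -> P^0. *)
Definition gorenstein_projective (N : lmodType R) : Prop :=
  exists (P : int -> lmodType R) (d : forall i : int, {linear P i -> P (i + 1)}),
    [/\ forall i, projective (P i),
        forall i, exact_at (d i) (d (i + 1)),
        forall Q : lmodType R, projective Q ->
          forall i, hom_exact (d i) (d (i + 1)) Q
      & exists j : {linear N -> P (0 + 1)},
          injective j /\
          forall y, (exists n, j n = y) <-> (exists x, d 0 x = y)].

(* There is an exact sequence 0 -> G_m -> ... -> G_0 -> N -> 0 with every G_i
   Gorenstein projective; it is continued by zero modules beyond m. *)
Definition gproj_resolution (N : lmodType R) (m : nat) : Prop :=
  exists (G : nat -> lmodType R)
         (d : forall i : nat, {linear G i.+1 -> G i}) (eps : {linear G 0 -> N}),
    [/\ forall i : nat, gorenstein_projective (G i),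
        forall i : nat, (m < i)%N -> forall x : G i, x = 0,
        surj eps, exact_at (d 0) eps
      & forall i : nat, exact_at (d i.+1) (d i)].

(* Gpd(N) <= d. The bound is an integer so that d - 1 makes sense for d = 0;
   nothing, not even the zero module, has Gpd <= -1. *)
Definition Gpd_le (N : lmodType R) (d : int) : Prop :=
  exists m : nat, m%:Z <= d /\ gproj_resolution N m.

(* G-gldim(R) = d: the least upper bound of the Gpd(N) is the natural number
   d. *)
Definition G_gldim_eq (d : nat) : Prop :=
  (forall N : lmodType R, Gpd_le N d) /\
  forall e : nat, (forall N : lmodType R, Gpd_le N e) -> (d <= e)%N.

Definition fg_free (F : lmodType R) : Prop :=
  exists (r : nat) (f : {linear 'rV[R]_r -> F}), bijective f.

(* There is an exact sequence F_n -> ... -> F_0 -> N -> 0; the modules and maps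
   of index beyond n are unconstrained. *)
Definition n_presented (n : nat) (N : lmodType R) : Prop :=
  exists (F : nat -> lmodType R)
         (d : forall i : nat, {linear F i.+1 -> F i}) (eps : {linear F 0 -> N}),
    [/\ forall i : nat, (i <= n)%N -> fg_free (F i),
        surj eps, (0 < n)%N -> exact_at (d 0) eps
      & forall i : nat, (i.+1 < n)%N -> exact_at (d i.+1) (d i)].

End GorensteinProjective.

Definition G_ring (R : comPzRingType) (n : nat) (d : int) : Prop :=
  forall N : lmodType R, n_presented n N -> Gpd_le N d.

(* Main.v *)
Require Import Defs.
From HB Require Import structures.
From mathcomp Require Import all_boot all_order all_algebra.
From mathcomp Require Import boolp classical_sets functions.
Set Implicit Arguments.
Unset Strict Implicit.
Unset Printing Implicit Defensive.
Import Order.TTheory GRing.Theory Num.Theory Defs.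
Local Open Scope ring_scope.
Local Open Scope quotient_scope.

(** Let k = A / M, let s = (0, 1) in R = A ∝ k, and let m be the annihilator
of s, that is, the ideal of the (a, e) with a in M.  Then s ^ 2 = 0, and
(a, e) |-> (0, e) makes the simple module s R = k a direct summand of m
([socle_retraction], [trivial_ext_socle]).  Everything about R follows from
this summand.

First claim.  Every 3-presented N is projective
([three_presented_projective]).  Cover N by a free module with the least
possible number of generators; as R is local, the kernel K0 lies in m R^a, so
s kills K0.  Cover K0 minimally by R^b, with kernel K1.  Then
s R^b <= K1 <= m R^b, so if b > 0, the module k is a direct summand of K1.  Up
to projective summands, K1 is the corresponding syzygy in the given
presentation, which is finitely presented; hence so is k, and m and M are
finitely generated.  When M is not, b = 0, thus K0 = 0 and N is free.

Second claim.  Let a in M be regular.  The annihilator of (a, 0) is s R, so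
R / (a, 0) is 2-presented with second syzygy s R ([not_G_ring_2]).  The
sequence 0 -> m -> R -> s R -> 0 and the summand s R of m show that
Ext^(n+1)(s R, R) = 0 implies Ext^n(s R, R) = 0 for n >= 1.  A finite
Gorenstein projective dimension would make these groups vanish for large n,
hence for all n >= 1, and the projection m -> s R would be the multiplication
by some (b, g).  Then b a = 0, so b = 0, and (b, g) cannot fix s.

Third claim.  A module over T = R * S is a pair of modules, each factor being
reached by an exact functor with an exact adjoint ([ring_factor]); so the
first claim and the hypothesis on S bound the dimension of 3-presented modules
([product_G_ring_3]).  The second claim holds over T with the elements (s, 0)
and ((a, 0), 1).  Finally, S being Noetherian, every cyclic S-module S / I is
3-presented over T.  If the bound d - 1 held over T, then Ext^d(S / I, Q) = 0
for all ideals I and all projective Q.  By Baer's criterion, applied to an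
iterated cosyzygy of Q, Ext^d(N, Q) = 0 for all N ([ext_baer]).  A (d - 1)-st
syzygy of N is then orthogonal to all projectives; having finite Gorenstein
projective dimension, it is Gorenstein projective ([perp_gdim]), so d would
not be the least bound ([gdim_from_cyclic]).

Only the vanishing of Ext matters, and it is defined by dimension shifting in
the second variable along a chosen embedding in an injective module; no
comparison of projective resolutions is needed.  Totally acyclic complexes
are handled through their modules of cycles, as bi-infinite [chain]s. *)

(** * Submodules, quotients and short exact sequences *)
Section Modules.
Variable R : comPzRingType.
Implicit Types U V W X K G N P Q J Y : lmodType R.

Definition lin_of U V (f : U -> V) (fL : linear f) : {linear U -> V} :=
  HB.pack f (GRing.isLinear.Build R U V *:%R f fL).

Definition submodule_closed V (I : V -> Prop) : Prop :=
  [/\ I 0, forall x y, I x -> I y -> I (x + y) & forall a x, I x -> I (a *: x)].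

Record submodule V := Submodule {
  smem :> V -> Prop;
  smemP : submodule_closed smem }.

Lemma smem0 V (I : submodule V) : I 0.
Proof. by case: (smemP I). Qed.
Lemma smemD V (I : submodule V) x y : I x -> I y -> I (x + y).
Proof. by case: (smemP I) => _ + _; apply. Qed.
Lemma smemZ V (I : submodule V) a x : I x -> I (a *: x).
Proof. by case: (smemP I) => _ _; apply. Qed.

(** Decidable by excluded middle, so that the generic constructions of subtypes
and quotients apply to an arbitrary submodule. *)
Definition spred V (I : submodule V) : {pred V} := fun x => `[< I x >].

Lemma spred_closed V (I : submodule V) : subsemimod_closed (spred I).
Proof.
split; first split.
- exact/asboolP/smem0.
- by move=> x y /asboolP ? /asboolP ?; apply/asboolP/smemD.
- by move=> a x /asboolP ?; apply/asboolP/smemZ.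
Qed.

HB.instance Definition _ V (I : submodule V) :=
  GRing.isSubmodClosed.Build R V (spred I) (spred_closed I).

Record subof V (I : submodule V) := SubOf {
  subof_val : V;
  subof_valP : spred I subof_val }.

HB.instance Definition _ V (I : submodule V) :=
  [isSub of subof I for @subof_val V I].
HB.instance Definition _ V (I : submodule V) := [Choice of subof I by <:].
HB.instance Definition _ V (I : submodule V) :=
  [SubChoice_isSubLmodule of subof I by <:].

(** The inclusion and the projection are sealed: simplification would otherwise
unfold them to their underlying functions and lose their linearity. *)
Lemma incl_subproof V (I : submodule V) :
  {i : {linear subof I -> V} | i =1 \val}.
Proof. by exists \val. Qed.
Definition incl V (I : submodule V) : {linear subof I -> V} :=
  sval (incl_subproof I).

Lemma incl_inj V (I : submodule V) : injective (incl I).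
Proof. by move=> x y; rewrite !(svalP (incl_subproof I)); exact: val_inj. Qed.

Lemma inclP V (I : submodule V) x : I (incl I x).
Proof. by rewrite (svalP (incl_subproof I)); exact/asboolP/(valP x). Qed.

Lemma incl_surj V (I : submodule V) v : I v -> exists x, incl I x = v.
Proof.
by move/asboolP=> Iv; exists (SubOf Iv); rewrite (svalP (incl_subproof I)).
Qed.

Definition quotof V (I : submodule V) : Type := @Quotient.quot V (spred I).
HB.instance Definition _ V (I : submodule V) := GRing.Zmodule.on (quotof I).

Definition qpi V (I : submodule V) (x : V) : quotof I := \pi_(Quotient.quot (spred I)) x.

Lemma qpi_eq V (I : submodule V) x y : qpi I x = qpi I y <-> I (x - y).
Proof.
rewrite /qpi; split.
  by move/eqP; rewrite eqmodE /= /Quotient.equiv; move/asboolP.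
by move=> Ixy; apply/eqP; rewrite eqmodE /= /Quotient.equiv; apply/asboolP.
Qed.

Lemma qpi_surj V (I : submodule V) x : exists v, qpi I v = x.
Proof. by exists (repr (x : Quotient.quot (spred I))); rewrite /qpi reprK. Qed.

Lemma qpiD V (I : submodule V) x y : qpi I (x + y) = qpi I x + qpi I y.
Proof. by rewrite /qpi raddfD. Qed.

Definition qscale V (I : submodule V) (a : R) (x : quotof I) : quotof I :=
  qpi I (a *: repr (x : Quotient.quot (spred I))).

Lemma qscaleE V (I : submodule V) a x : qscale a (qpi I x) = qpi I (a *: x).
Proof.
apply/qpi_eq; rewrite -scalerBr; apply: smemZ; apply/qpi_eq.
by rewrite /qpi reprK.
Qed.

Section QuotientLmodule.
Variables (V : lmodType R) (I : submodule V).

Lemma qscaleA a b (x : quotof I) : qscale a (qscale b x) = qscale (a * b) x.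
Proof. by have [v <-] := qpi_surj x; rewrite !qscaleE scalerA. Qed.
Lemma qscale1 : left_id 1 (@qscale V I).
Proof. by move=> x; have [v <-] := qpi_surj x; rewrite qscaleE scale1r. Qed.
Lemma qscaleDr : right_distributive (@qscale V I) +%R.
Proof.
move=> a x y; have [v <-] := qpi_surj x; have [w <-] := qpi_surj y.
by rewrite -qpiD !qscaleE scalerDr qpiD.
Qed.
Lemma qscaleDl (x : quotof I) : {morph (@qscale V I)^~ x : a b / a + b}.
Proof.
by move=> a b; have [v <-] := qpi_surj x; rewrite !qscaleE scalerDl qpiD.
Qed.

HB.instance Definition _ := GRing.Zmodule_isLmodule.Build R (quotof I)
  qscaleA qscale1 qscaleDr qscaleDl.

Lemma qpi_linear : linear (qpi I : V -> quotof I).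
Proof. by move=> a x y; rewrite qpiD -qscaleE. Qed.
End QuotientLmodule.

Lemma proj_subproof V (I : submodule V) :
  {p : {linear V -> quotof I} | p =1 qpi I}.
Proof. by exists (lin_of (@qpi_linear V I)). Qed.
Definition proj V (I : submodule V) : {linear V -> quotof I} :=
  sval (proj_subproof I).

Lemma projE V (I : submodule V) x : proj I x = qpi I x.
Proof. exact: (svalP (proj_subproof I)). Qed.

Lemma proj_surj V (I : submodule V) : surj (proj I).
Proof. by move=> x; have [v <-] := qpi_surj x; exists v; rewrite projE. Qed.

Lemma proj_eq0 V (I : submodule V) x : proj I x = 0 <-> I x.
Proof.
by rewrite -[X in _ = X](linear0 (proj I)) !projE qpi_eq subr0.
Qed.

Lemma ker_closed U V (f : {linear U -> V}) : submodule_closed (fun x => f x = 0).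
Proof.
split; first exact: linear0.
- by move=> x y fx fy; rewrite linearD fx fy addr0.
- by move=> a x fx; rewrite linearZ /= fx scaler0.
Qed.
Definition ker U V (f : {linear U -> V}) := Submodule (ker_closed f).

Lemma im_closed U V (f : {linear U -> V}) :
  submodule_closed (fun y => exists x, f x = y).
Proof.
split; first by exists 0; rewrite linear0.
- by move=> _ _ [x <-] [y <-]; exists (x + y); rewrite linearD.
- by move=> a _ [x <-]; exists (a *: x); rewrite linearZ.
Qed.
Definition im U V (f : {linear U -> V}) := Submodule (im_closed f).

Definition ses K G N (i : {linear K -> G}) (p : {linear G -> N}) : Prop :=
  [/\ injective i, surj p & exact_at i p].

Lemma lin_inj U V (f : {linear U -> V}) :
  (forall x, f x = 0 -> x = 0) -> injective f.
Proof.
by move=> f0 x y exy; apply/subr0_eq/f0; rewrite linearB exy subrr.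
Qed.

Lemma ses_ker U V (f : {linear U -> V}) : surj f -> ses (incl (ker f)) f.
Proof.
move=> fs; split; [exact: incl_inj | by [] |].
move=> v; split=> [fv|[u <-]]; first exact: incl_surj.
exact: (inclP u).
Qed.

Lemma ses_coker U V (f : {linear U -> V}) : injective f -> ses f (proj (im f)).
Proof.
by move=> fi; split=> //; [exact: proj_surj|move=> v; exact: proj_eq0].
Qed.

Lemma exact_comp0 K G N (i : {linear K -> G}) (p : {linear G -> N}) :
  exact_at i p -> forall x, p (i x) = 0.
Proof. by move=> e x; apply/e; exists x. Qed.

Lemma factor_surj U V W (p : {linear U -> V}) (f : {linear U -> W}) :
  surj p -> (forall x, p x = 0 -> f x = 0) ->
  exists g : {linear V -> W}, forall x, g (p x) = f x.
Proof.
move=> ps pf; have [s sK] := choice ps.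
have fE x y : p x = p y -> f x = f y.
  by move=> e; apply/subr0_eq; rewrite -linearB; apply: pf; rewrite linearB e subrr.
have gL : linear (f \o s).
  by move=> a x y /=; rewrite -linearP; apply: fE; rewrite linearP !sK.
by exists (lin_of gL) => x /=; apply: fE; rewrite sK.
Qed.

Lemma factor_inj U V W (i : {linear U -> V}) (f : {linear W -> V}) :
  injective i -> (forall x, exists u, i u = f x) ->
  exists g : {linear W -> U}, forall x, i (g x) = f x.
Proof.
move=> ii /choice[g gE].
have gL : linear g by move=> a x y; apply: ii; rewrite linearP !gE linearP.
by exists (lin_of gL).
Qed.

Lemma linear_inv U V (f : {linear U -> V}) : injective f -> surj f ->
  exists g : {linear V -> U}, cancel f g /\ cancel g f.
Proof.
move=> fi fs; have [g gE] := @factor_inj _ _ _ f (idfun : {linear V -> V}) fi fs.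
by exists g; split=> x; [apply: fi|]; rewrite gE.
Qed.

Lemma injl_linear U V : linear (fun x : U => (x, 0) : (U * V)%type).
Proof. by move=> a x y; congr pair; rewrite /= scaler0 addr0. Qed.
Definition injl U V : {linear U -> (U * V)%type} := lin_of (@injl_linear U V).

Lemma injr_linear U V : linear (fun x : V => (0, x) : (U * V)%type).
Proof. by move=> a x y; congr pair; rewrite /= scaler0 addr0. Qed.
Definition injr U V : {linear V -> (U * V)%type} := lin_of (@injr_linear U V).

Definition iso U V := exists f : {linear U -> V}, injective f /\ surj f.

Lemma iso_refl U : iso U U.
Proof. by exists (idfun : {linear U -> U}); split=> // x; exists x. Qed.
Lemma iso_sym U V : iso U V -> iso V U.
Proof.
move=> [f [fi fs]]; have [g [fK gK]] := linear_inv fi fs.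
by exists g; split; [exact: can_inj gK|move=> x; exists (f x)].
Qed.
Lemma iso_trans U V W : iso U V -> iso V W -> iso U W.
Proof.
move=> [f [fi fs]] [g [gi gs]]; exists (g \o f); split.
  exact: inj_comp.
by move=> w; have [v <-] := gs w; have [u <-] := fs v; exists u.
Qed.

End Modules.

(** * Injective modules *)
Section Zorn.
Variables (R : comPzRingType) (V : lmodType R).

(** Serves twice: [Q] excludes the graphs that are not functional when linear
maps are extended, and the element 1 when an ideal is enlarged to a maximal
one. *)
Lemma zorn_submodule (I : submodule V) (Q : V -> Prop) :
  (forall x, I x -> Q x) ->
  exists J : submodule V, [/\ forall x, I x -> J x, forall x, J x -> Q x &
    forall J' : submodule V, (forall x, J x -> J' x) ->
      (forall x, J' x -> Q x) -> forall x, J' x -> J x].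
Proof.
move=> IQ.
(* [I] is added to every set so that the empty chain also has an upper bound. *)
pose P (A : set V) := submodule_closed (fun z => I z \/ A z) /\
  forall z, I z \/ A z -> Q z.
have P0 : P set0.
  split=> [|z [/IQ//|//]]; split; first by left; exact: smem0.
  - by move=> x y [Ix|//] [Iy|//]; left; exact: smemD.
  - by move=> a x [Ix|//]; left; exact: smemZ.
have [|A [[AS AQ] Amax]] := @Zorn_bigcup _ P.
  move=> F FP Ftot.
  pose F' Z := F Z \/ Z = set0.
  have F'P Z : F' Z -> P Z by case=> [/FP//|->].
  have F'U Z z : F' Z -> I z \/ Z z -> I z \/ (\bigcup_(i in F) i)%classic z.
    by case=> [FZ|->] [|zZ]; [left|right; exists Z|left|case: zZ].
  have UF' z : I z \/ (\bigcup_(i in F) i)%classic z -> exists2 Z, F' Z & I z \/ Z z.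
    by case=> [|[Z FZ Zz]]; [exists set0; [right|left]|exists Z; [left|right]].
  have F'tot Z W : F' Z -> F' W ->
      exists2 T, F' T & (Z `<=` T)%classic /\ (W `<=` T)%classic.
    move=> [FZ|->] [FW|->].
    - by have [ZW|WZ] := Ftot _ _ FZ FW; [exists W|exists Z]; by [left|split].
    - by exists Z; [left|split=> //; apply: sub0set].
    - by exists W; [left|split=> //; apply: sub0set].
    - by exists set0; [right|split].
  split; last by move=> x /UF'[Z /F'P[_ Zf] /Zf].
  split; first by left; exact: smem0.
  - move=> z w /UF'[Z FZ zZ] /UF'[W FW wW].
    have [T FT [ZT WT]] := F'tot _ _ FZ FW.
    apply: (F'U T) => //; have [[_ + _] _] := F'P _ FT; apply.
      by case: zZ => [|/ZT]; [left|right].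
    by case: wW => [|/WT]; [left|right].
  - move=> a z /UF'[Z FZ zZ]; apply: (F'U Z) => //.
    by have [[_ _ +] _] := F'P _ FZ; apply.
exists (Submodule AS); split=> [x Ix|//|J' AJ' J'Q x J'x]; first by left.
right; apply: contrapT => nAx; apply: (Amax J').
  split; first by move=> y Ay; apply: AJ'; right.
  by move/(_ _ J'x).
have JE : (fun z => I z \/ J' z) = smem J'.
  apply/funext => z; apply/propext.
  by split; [case=> // Iz; apply/AJ'; left|right].
rewrite /P JE; split; first exact: smemP.
by move=> z [/IQ|/J'Q].
Qed.

End Zorn.

Section Injective.
Variable R : comPzRingType.
Implicit Types U V X : lmodType R.

(** For injective [f] this is the usual extension property; since [h] factors
through the image of [f], the form with kernels is equivalent and spares the
construction of that image. *)
Definition injective_module X : Prop :=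
  forall U V (f : {linear U -> V}) (h : {linear U -> X}),
    (forall u, f u = 0 -> h u = 0) ->
    exists g : {linear V -> X}, forall u, g (f u) = h u.

Definition graph_of_linear V X (G : V * X -> Prop) : Prop :=
  submodule_closed (G : (V * X)%type -> Prop) /\ forall x, G (0, x) -> x = 0.

(** Baer's condition on ideals; maps from an ideal are given by their graphs, so
that the domain need not be a type. *)
Definition baer_property X : Prop :=
  forall G : R^o * X -> Prop, graph_of_linear G ->
    exists y, forall r x, G (r, x) -> x = r *: y.

(** The r with r v0 in the domain of the partial map form an ideal; the value
[y] for v0 is the element that represents the induced map on it. *)
Lemma graph_of_linear_ext V X (G : V * X -> Prop) (v0 : V) :
  baer_property X -> graph_of_linear G ->
  exists y, graph_of_linear (fun z => exists r, G (z.1 - r *: v0, z.2 - r *: y)).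
Proof.
move=> bX [[G0 GD GZ] Gf].
have GN z : G z -> G (- z) by move=> /(GZ (-1)); rewrite scaleN1r.
have [y yP] : exists y, forall r x, G (r *: v0, x) -> x = r *: y.
  apply: (bX (fun z => G (z.1 *: v0, z.2))); split; last first.
    by move=> x /=; rewrite scale0r; exact: Gf.
  split=> [|[r x] [s z] /= Gx Gz|a [r x] /= Gx] /=.
  - by rewrite scale0r.
  - by rewrite scalerDl; have := GD _ _ Gx Gz.
  - by have := GZ a _ Gx; rewrite -scalerA.
exists y; split.
  split=> [|[v x] [w z] /= [r Gr] [s Gs]|a [v x] /= [r Gr]].
  - by exists 0; rewrite /= !scale0r !subr0.
  - exists (r + s); rewrite !scalerDl !opprD !addrA.
    have := GD _ _ Gr Gs; rewrite /=; congr G; congr pair => /=.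
      by rewrite -!addrA; congr (_ + _); rewrite addrCA.
    by rewrite -!addrA; congr (_ + _); rewrite addrCA.
  - by exists (a * r); have := GZ a _ Gr; rewrite -!scalerA -!scalerBr.
move=> x [r /= Gr].
have {Gr} := GN _ Gr; rewrite sub0r => Gr.
have Gr' : G (r *: v0, r *: y - x) by move: Gr; congr G; congr pair; rewrite /= ?opprK ?opprB.
by have := yP _ _ Gr' => /(congr1 (fun u => r *: y - u)); rewrite subKr subrr.
Qed.

(** Baer's criterion: a maximal extension of the map given on the image of [f]
is everywhere defined. *)
Lemma baer_injective X : baer_property X -> injective_module X.
Proof.
move=> bX U V f h fh.
have G0S : submodule_closed (fun z : (V * X)%type => exists u, z = (f u, h u)).
  split; first by exists 0; rewrite !linear0.
  - by move=> z w [u ->] [u' ->]; exists (u + u'); rewrite !linearD.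
  - by move=> a z [u ->]; exists (a *: u); rewrite !linearZ.
have [|G [G0G Gf Gmax]] :=
    @zorn_submodule _ _ (Submodule G0S) (fun z => z.1 = 0 -> z.2 = 0).
  by move=> _ [u ->] /=; exact: fh.
have {}Gf x : G (0, x) -> x = 0 by move/Gf; apply.
have Gtot v : exists x, G (v, x).
  have [y [G'S G'f]] := graph_of_linear_ext v bX (conj (smemP G) Gf).
  exists y; apply: (Gmax (Submodule G'S)).
  - by move=> z Gz; exists 0; rewrite !scale0r !subr0; case: z Gz.
  - by move=> [w x] + /= w0; rewrite w0; exact: G'f.
  - by exists 1; rewrite /= !scale1r !subrr; exact: smem0.
have [g gG] := choice Gtot.
have [_ GD GZ] := smemP G.
have Gu v x y : G (v, x) -> G (v, y) -> x = y.
  move=> Gx Gy; apply/subr0_eq/Gf.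
  have := GD _ _ Gx (GZ (-1) _ Gy).
  rewrite [_ + _](_ : _ = (0, x - y)) //.
  by congr pair => /=; rewrite scaleN1r ?subrr.
have gL : linear g.
  move=> a v w; apply: Gu (gG _) _.
  exact: GD _ _ (GZ a _ (gG v)) (gG w).
by exists (lin_of gL) => u /=; apply: Gu (gG _) _; apply: G0G; exists u.
Qed.

End Injective.

Lemma rat_int_closed :
  submodule_closed (fun x : zmodule rat => exists n : int, x = n%:~R).
Proof.
split; first by exists 0.
- by move=> _ _ [m ->] [n ->]; exists (m + n); rewrite rmorphD.
- by move=> a _ [n ->]; exists (a * n); rewrite rmorphM /= scalezrE mulrzl.
Qed.
Definition rat_int : submodule _ := Submodule rat_int_closed.
Definition QmodZ : lmodType int := quotof rat_int.

(** The ideals of the integers are principal: take the least positive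
element. *)
Lemma int_relation_generated (P : int -> Prop) :
  P 0 -> (forall x y, P x -> P y -> P (x + y)) -> (forall a x, P x -> P (a * x)) ->
  exists n : nat, P n /\ forall z, P z -> exists t, z = t * n%:Z.
Proof.
move=> P0 PD PM.
have [Pz|] := pselect (forall z, P z -> z = 0).
  by exists 0; split=> // z /Pz ->; exists 0; rewrite mul0r.
move/existsNP=> [z /not_implyP[Pz z0]].
have ex : exists n : nat, `[< P n /\ (0 < n)%N >].
  exists `|z|%N; apply/asboolP; split; last by rewrite absz_gt0; apply/eqP.
  rewrite abszE; case: (ger0P z) => // _; rewrite -mulN1r; exact: PM.
case: (ex_minnP ex) => n /asboolP[Pn n0] nmin.
exists n; split=> // w Pw; exists (w %/ n)%Z.
have nz : n%:Z != 0 by rewrite -lt0n.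
rewrite {1}(divz_eq w n); suff -> : (w %% n)%Z = 0 by rewrite addr0.
have wge := modz_ge0 w nz; have wlt := ltz_pmod w (n0 : 0 < n%:Z).
have Pr : P (w %% n)%Z.
  have -> : (w %% n)%Z = w + (- (w %/ n)%Z) * n.
    by rewrite {2}(divz_eq w n) mulNr [_ + (_ %% _)%Z]addrC addrK.
  by apply: PD => //; apply: PM.
case: (modz w n) wge wlt Pr => // k _; rewrite ltz_nat => kn Pk.
case: k kn Pk => // k kn Pk.
have /nmin : `[< P k.+1 /\ (0 < k.+1)%N >] by apply/asboolP.
by rewrite leqNgt kn.
Qed.

Lemma QmodZ_divisible (x : QmodZ) (n : int) : n != 0 -> exists y, x = n *: y.
Proof.
move=> n0; have [q <-] := qpi_surj x.
exists (qpi rat_int (q / n%:~R : rat)); rewrite [RHS]qscaleE; congr qpi.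
by rewrite scalezrE -mulrzl mulrCA divff ?mulr1 // intr_eq0.
Qed.

(** A divisible group is injective. *)
Lemma QmodZ_injective : injective_module QmodZ.
Proof.
apply: baer_injective => G [[G0 GD GZ] Gf].
have [|||n [[x Gx] nP]] := @int_relation_generated (fun n => exists x, G (n, x)).
- by exists 0.
- by move=> x y [u Gu] [v Gv]; exists (u + v); exact: GD _ _ Gu Gv.
- by move=> a x [u Gu]; exists (a *: u); exact: GZ a _ Gu.
have Gt r z : G (r, z) -> exists t, r = t * n%:Z /\ z = t *: x.
  move=> Gz; have [|t rt] := nP r; first by exists z.
  exists t; split=> //; apply/subr0_eq/Gf.
  have := GD _ _ Gz (GZ (- t) _ Gx); rewrite [_ + _](_ : _ = (0, z - t *: x)) //.
  congr pair; rewrite /= ?scaleNr // rt -[t *: _]/(t * n%:Z).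
  by rewrite subrr.
have [n0|n0] := eqVneq n%:Z 0.
  have x0 : x = 0 by apply: Gf; rewrite -n0.
  by exists 0 => r z /Gt[t [_ ->]]; rewrite x0 !scaler0.
have [y yP] := QmodZ_divisible x n0.
by exists y => r z /Gt[t [-> ->]]; rewrite yP scalerA.
Qed.

Lemma QmodZ_inv_neq0 n : (1 < n)%N -> qpi rat_int (n%:R^-1 : rat) <> 0.
Proof.
move=> n1; rewrite -projE => /(proj_eq0 rat_int (n%:R^-1 : rat))[m].
move/(congr1 ( *%R n%:R)); rewrite divff ?pnatr_eq0 -?lt0n ?(ltn_trans _ n1) //.
rewrite -[n%:R]/(n%:Z%:~R) -intrM => /eqP; rewrite -[1]/(1%:~R) eqr_int => /eqP.
move/(congr1 absz); rewrite abszM /= => /esym/eqP; rewrite muln_eq1 => /andP[/eqP n1' _].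
by rewrite n1' in n1.
Qed.

(** Let n generate the annihilator of [x].  The class of 1 / n, or of 1 / 2 when
n = 0, is nonzero and killed by n, so that [x] may be sent to it. *)
Lemma QmodZ_separates (V : lmodType int) (x : V) : x <> 0 ->
  exists chi : {linear V -> QmodZ}, chi x <> 0.
Proof.
move=> x0.
have [|||n [nx nP]] := @int_relation_generated (fun n => n *: x = 0).
- by rewrite scale0r.
- by move=> a b ax bx; rewrite scalerDl ax bx addr0.
- by move=> a b bx; rewrite -scalerA bx scaler0.
have [y y0 ny] : exists2 y : QmodZ, y <> 0 & n%:Z *: y = 0.
  case: n nx {nP} => [|[|n]] nx.
  - by exists (qpi rat_int (2%:R^-1 : rat)); rewrite ?scale0r //; exact: QmodZ_inv_neq0.
  - by case: x0; rewrite -[x]scale1r.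
  - exists (qpi rat_int (n.+2%:R^-1 : rat)); first exact: QmodZ_inv_neq0.
    rewrite [LHS]qscaleE -projE; apply/(proj_eq0 rat_int); exists 1.
    by rewrite scalezrE -mulrzl mulfV // intr_eq0.
have sL (W : lmodType int) (w : W) : linear (fun z : int^o => z *: w).
  by move=> a b c; rewrite scalerDl -scalerA.
have [u /= u0|g gE] := QmodZ_injective (f := lin_of (sL V x)) (h := lin_of (sL QmodZ y)).
  by have [t ->] := nP _ u0; rewrite -scalerA ny scaler0.
by exists g; have /= := gE 1; rewrite !scale1r => ->.
Qed.

Lemma additive_int_linear (U V : lmodType int) (f : U -> V) :
  (forall x y, f (x + y) = f x + f y) -> linear f.
Proof.
move=> fD.
have f0 : f 0 = 0 by apply: (addrI (f 0)); rewrite -fD !addr0.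
have fN x : f (- x) = - f x by apply: (addrI (f x)); rewrite -fD !subrr.
have fB : zmod_morphism f by move=> x y; rewrite fD fN.
pose g : {additive U -> V} := HB.pack f (GRing.isZmodMorphism.Build U V f fB).
have scE (W : lmodType int) (w : W) (n : int) : n *: w = w *~ n.
  by rewrite -{1}[n]intz scaler_int.
by move=> a x y; rewrite fD !scE -[f (x *~ a)]/(g (x *~ a)) raddfMz.
Qed.

(** The [I]-fold power of the module Hom(R, Q/Z) of additive maps, on which a
scalar acts by multiplication of the argument. *)
Section Coinduced.
Variables (R : comPzRingType) (I : Type).

Definition coind_pred : {pred I -> R -> QmodZ} :=
  fun F => `[< forall i x y, F i (x + y) = F i x + F i y >].

Lemma coind_closed : zmod_closed coind_pred.
Proof.
split; first by apply/asboolP => i x y; rewrite [RHS]addr0.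
move=> F G /asboolP FD /asboolP GD; apply/asboolP => i x y.
rewrite -[(F - G) i (x + y)]/(F i (x + y) - G i (x + y)) FD GD opprD.
by rewrite addrACA.
Qed.
HB.instance Definition _ := GRing.isZmodClosed.Build _ coind_pred coind_closed.

Record coind := Coind { coind_val : I -> R -> QmodZ; coind_valP : coind_pred coind_val }.
HB.instance Definition _ := [isSub of coind for coind_val].
HB.instance Definition _ := [Choice of coind by <:].
HB.instance Definition _ := [SubChoice_isSubZmodule of coind by <:].

Lemma coindD (F : coind) i x y :
  coind_val F i (x + y) = coind_val F i x + coind_val F i y.
Proof. by have /asboolP := coind_valP F. Qed.

Lemma coind_scale_subproof (a : R) (F : coind) :
  coind_pred (fun i s => coind_val F i (s * a)).
Proof. by apply/asboolP => i x y; rewrite mulrDl coindD. Qed.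
Definition coind_scale a F := Coind (coind_scale_subproof a F).

Lemma coind_eq (F G : coind) :
  (forall i s, coind_val F i s = coind_val G i s) -> F = G.
Proof. by move=> FG; apply/val_inj/funext => i; apply/funext => s; exact: FG. Qed.

Lemma coind_scaleA a b F : coind_scale a (coind_scale b F) = coind_scale (a * b) F.
Proof. by apply: coind_eq => i s /=; rewrite mulrA. Qed.
Lemma coind_scale1 : left_id 1 coind_scale.
Proof. by move=> F; apply: coind_eq => i s /=; rewrite mulr1. Qed.
Lemma coind_scaleDr : right_distributive coind_scale +%R.
Proof. by move=> a F G; apply: coind_eq => i s. Qed.
Lemma coind_scaleDl F : {morph coind_scale^~ F : a b / a + b}.
Proof. by move=> a b; apply: coind_eq => i s /=; rewrite mulrDr coindD. Qed.
HB.instance Definition _ := GRing.Zmodule_isLmodule.Build R coind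
  coind_scaleA coind_scale1 coind_scaleDr coind_scaleDl.

Lemma coindZE a (F : coind) i s : coind_val (a *: F) i s = coind_val F i (s * a).
Proof. by []. Qed.

(** An R-linear map to Hom(R, Q/Z) is the same thing as an additive map to Q/Z,
by evaluation at 1; the injectivity of Q/Z is thus inherited. *)
Lemma coind_injective : injective_module (coind : lmodType R).
Proof.
move=> U V f h fh.
have fL : linear (f : zmodule U -> zmodule V).
  by apply: additive_int_linear => x y; exact: linearD.
have hL i : linear ((fun u => coind_val (h u) i 1) : zmodule U -> QmodZ).
  by apply: additive_int_linear => x y; rewrite [h _]linearD.
have /choice[g gE] i := @QmodZ_injective _ _ (lin_of fL) (lin_of (hL i))
  (fun u fu0 => congr1 (fun F => coind_val F i 1) (fh u fu0)).
have gc v : coind_pred (fun i s => g i (s *: v)).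
  by apply/asboolP => i x y; rewrite scalerDl (linearD (g i)).
have gL : linear (fun v => Coind (gc v)).
  move=> a v w; apply: coind_eq => i s /=.
  by rewrite scalerDr scalerA; exact: (linearD (g i)).
exists (lin_of gL) => u; apply: coind_eq => i s /=.
rewrite -linearZ; have /= -> := gE i (s *: u).
by rewrite linearZ coindZE mul1r.
Qed.
End Coinduced.

(** The power is indexed by all characters of [Q]; they separate points. *)
Lemma enough_injectives (R : comPzRingType) (Q : lmodType R) :
  exists (J : lmodType R) (i : {linear Q -> J}),
    injective_module J /\ injective i.
Proof.
pose I := {linear zmodule Q -> QmodZ}.
have ic (x : Q) : coind_pred (fun (chi : I) (s : R) => chi (s *: x)).
  by apply/asboolP => chi s t; rewrite scalerDl (linearD chi).
have iL : linear (fun x => Coind (ic x)).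
  move=> a x y; apply: coind_eq => chi s /=.
  by rewrite scalerDr scalerA; exact: (linearD chi).
exists (coind R I), (lin_of iL); split; first exact: coind_injective.
apply: lin_inj => x ix0; apply: contrapT => x0.
have [chi] := @QmodZ_separates (zmodule Q) x x0; apply.
have := congr1 (fun F => coind_val F chi 1) ix0.
by rewrite /= scale1r.
Qed.

(** * Vanishing of Ext and Gorenstein projective modules *)
Section Ext.
Variable R : comPzRingType.
Implicit Types U V W X K G N P Q J Y : lmodType R.

(** One embedding 0 -> Q -> J -> C -> 0 in an injective module is fixed for each
[Q], as opaque data: only its exactness and the injectivity of [J] count. *)
Lemma hull_subproof Q :
  {J : lmodType R & {C : lmodType R & {i : {linear Q -> J} &
    {p : {linear J -> C} | injective_module J /\ ses i p}}}}.
Proof.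
have [J /cid[i [Ji ii]]] := cid (enough_injectives Q).
by exists J, (quotof (im i)), i, (proj (im i)); split=> //; exact: ses_coker.
Qed.
Definition hull Q : lmodType R := projT1 (hull_subproof Q).
Definition cosyz Q : lmodType R := projT1 (projT2 (hull_subproof Q)).
Definition hull_emb Q : {linear Q -> hull Q} :=
  projT1 (projT2 (projT2 (hull_subproof Q))).
Definition hull_proj Q : {linear hull Q -> cosyz Q} :=
  sval (projT2 (projT2 (projT2 (hull_subproof Q)))).

Lemma hull_injective Q : injective_module (hull Q).
Proof. exact: (svalP (projT2 (projT2 (projT2 (hull_subproof Q))))).1. Qed.

Lemma hull_ses Q : ses (hull_emb Q) (hull_proj Q).
Proof. exact: (svalP (projT2 (projT2 (projT2 (hull_subproof Q))))).2. Qed.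

(** The index is shifted: [ext_vanishes n N Q] is Ext^(n+1)(N, Q) = 0.  For n = 0
it says that Hom(N, J) -> Hom(N, C) is onto, where C is the cosyzygy of [Q];
the higher groups reduce to that case by Ext^(n+2)(N, Q) = Ext^(n+1)(N, C). *)
Fixpoint ext_vanishes (n : nat) N Q : Prop :=
  if n is n'.+1 then ext_vanishes n' N (cosyz Q) else
  forall f : {linear N -> cosyz Q},
    exists g : {linear N -> hull Q}, forall x, hull_proj Q (g x) = f x.

(** Extend [phi] to psi0 : G -> J by injectivity.  The map N -> C that psi0
induces lifts to J; subtracting the lift makes psi0 take its values in [Q]. *)
Lemma ext1_extend K G N Q (i : {linear K -> G}) (p : {linear G -> N})
    (phi : {linear K -> Q}) :
  ses i p -> ext_vanishes 0 N Q ->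
  exists psi : {linear G -> Q}, forall x, psi (i x) = phi x.
Proof.
move=> [ii ps ip] NQ; have [ei _ epi] := hull_ses Q.
have [x /= ix0|psi0 psi0E] := @hull_injective Q _ _ i (hull_emb Q \o phi).
  by rewrite (ii x 0) ?linear0 // ix0 linear0.
have [x px0|f fE] := @factor_surj _ _ _ _ p (hull_proj Q \o psi0) ps.
  by have /ip[y <-] := px0; rewrite /= psi0E /=; apply/epi; exists (phi y).
have [g gE] := NQ f.
have dL : linear (fun x => psi0 x - g (p x)).
  by move=> a x y; rewrite !linearP scalerDr addrACA.
have [x|psi psiE] := @factor_inj _ _ _ _ (hull_emb Q) (lin_of dL) ei.
  by apply/epi; rewrite /= linearB gE fE /= subrr.
exists psi => x; apply: ei; rewrite psiE /= psi0E /=.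
by rewrite (exact_comp0 ip) linear0 subr0.
Qed.

(** A map N -> C lifts to J after composition with [p]; the restriction of the
lift to [K] lands in [Q] and can be extended and subtracted, so that the lift
descends to [N]. *)
Lemma ext1_of_extend K G N Q (i : {linear K -> G}) (p : {linear G -> N}) :
  ses i p -> ext_vanishes 0 G Q ->
  (forall phi : {linear K -> Q},
     exists psi : {linear G -> Q}, forall x, psi (i x) = phi x) ->
  ext_vanishes 0 N Q.
Proof.
move=> [ii ps ip] GQ KQ f; have [ei _ epi] := hull_ses Q.
have [g gE] := GQ (f \o p).
have [x|phi phiE] := @factor_inj _ _ _ _ (hull_emb Q) (g \o i) ei.
  by apply/epi; rewrite /= gE /= (exact_comp0 ip) linear0.
have [psi psiE] := KQ phi.
have dL : linear (fun x => g x - hull_emb Q (psi x)).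
  by move=> a x y; rewrite !linearP scalerDr addrACA.
have [x /ip[y <-] /=|h hE] := @factor_surj _ _ _ _ p (lin_of dL) ps.
  by rewrite psiE phiE subrr.
exists h => y; have [x <-] := ps y; rewrite hE /= linearB gE /=.
by rewrite (exact_comp0 epi) subr0.
Qed.

(** This and the next two lemmas are the pieces of the long exact sequence in
the first variable; by the definition of the higher groups only the lowest
degree requires an argument. *)
Lemma ext_right n K G N Q (i : {linear K -> G}) (p : {linear G -> N}) :
  ses i p -> ext_vanishes n K Q -> ext_vanishes n.+1 G Q ->
  ext_vanishes n.+1 N Q.
Proof.
move=> s; elim: n Q => [|n IH] Q; last exact: IH.
move=> KQ GQ; apply: (ext1_of_extend s) => //= phi.
have [ii ps ip] := s; have [g gE] := KQ phi.
have [x /= ix0|psi psiE] := @hull_injective Q _ _ i g.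
  by rewrite (ii x 0) ?linear0 // ix0 linear0.
by exists (hull_proj Q \o psi) => x; rewrite /= psiE.
Qed.

Lemma ext_left n K G N Q (i : {linear K -> G}) (p : {linear G -> N}) :
  ses i p -> ext_vanishes n.+1 N Q -> ext_vanishes n G Q ->
  ext_vanishes n K Q.
Proof.
move=> s; elim: n Q => [|n IH] Q; last exact: IH.
move=> NQ GQ f; have [psi psiE] := ext1_extend f s NQ.
have [g gE] := GQ psi.
by exists (g \o i) => x; rewrite /= gE.
Qed.

Lemma ext_middle n K G N Q (i : {linear K -> G}) (p : {linear G -> N}) :
  ses i p -> ext_vanishes n K Q -> ext_vanishes n N Q ->
  ext_vanishes n G Q.
Proof.
move=> [ii ps ip]; elim: n Q => [|n IH] Q; last exact: IH.
move=> KQ NQ f; have [g gE] := KQ (f \o i).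
have [x /= ix0|psi psiE] := @hull_injective Q _ _ i g.
  by rewrite (ii x 0) ?linear0 // ix0 linear0.
have dL : linear (fun x => f x - hull_proj Q (psi x)).
  by move=> a x y; rewrite !linearP scalerDr addrACA.
have [x /ip[y <-] /=|h hE] := @factor_surj _ _ _ _ p (lin_of dL) ps.
  by rewrite psiE gE subrr.
have [h' h'E] := NQ h.
have sL : linear (fun x => psi x + h' (p x)).
  by move=> a x y; rewrite !linearP scalerDr addrACA.
by exists (lin_of sL) => x; rewrite /= linearD h'E hE /= addrCA subrr addr0.
Qed.

Lemma ext_retract n N N' Q (i : {linear N' -> N}) (r : {linear N -> N'}) :
  (forall x, r (i x) = x) -> ext_vanishes n N Q -> ext_vanishes n N' Q.
Proof.
move=> ri; elim: n Q => [|n IH] Q; last exact: IH.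
move=> NQ f; have [g gE] := NQ (f \o r).
by exists (g \o i) => x; rewrite /= gE /= ri.
Qed.

Lemma ext_iso n N N' Q : iso N N' -> ext_vanishes n N Q -> ext_vanishes n N' Q.
Proof.
move=> [f [fi fs]]; have [g [fK gK]] := linear_inv fi fs.
exact: ext_retract gK.
Qed.

Lemma ext_projective n P Q : projective P -> ext_vanishes n P Q.
Proof.
move=> Pp; elim: n Q => [|n IH] Q; last exact: IH.
by move=> f; have [_ ps _] := hull_ses Q; have [g gE] := Pp _ _ (hull_proj Q) f ps; exists g.
Qed.

(** A map from an ideal I to [Q] extends to [R] because Ext^1(R / I, Q) = 0, and
is then induced by the image of 1. *)
Lemma injective_of_ext Q :
  (forall I : submodule R^o, ext_vanishes 0 (quotof I) Q) -> injective_module Q.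
Proof.
move=> H; apply: baer_injective => G [[G0 GD GZ] Gf].
have Iclosed : submodule_closed (fun r : R^o => exists x, G (r, x)).
  split; first by exists 0.
  - by move=> r s [x Gx] [y Gy]; exists (x + y); exact: GD _ _ Gx Gy.
  - by move=> a r [x Gx]; exists (a *: x); exact: GZ a _ Gx.
pose I := Submodule Iclosed.
have [phi phiP] := choice (fun r : subof I => inclP r).
have Gu r x y : G (r, x) -> G (r, y) -> x = y.
  move=> Gx Gy; apply/subr0_eq/Gf.
  have := GD _ _ Gx (GZ (-1) _ Gy).
  rewrite [_ + _](_ : _ = (0, x - y)) //.
  by congr pair => /=; rewrite scaleN1r ?subrr.
have phiL : linear phi.
  move=> a r s; apply: Gu (phiP _) _.
  have := GD _ _ (GZ a _ (phiP r)) (phiP s); congr G; congr pair.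
  by rewrite linearP.
have s : ses (incl I) (proj I).
  split; [exact: incl_inj|exact: proj_surj|move=> r; split].
    by move/proj_eq0/incl_surj.
  by move=> [u <-]; apply/proj_eq0; exact: inclP.
have [psi psiE] := ext1_extend (lin_of phiL) s (H I).
exists (psi 1) => r x Gx; rewrite -linearZ /=.
have [u uE] := @incl_surj _ _ I r (ex_intro _ x Gx).
have -> : r *: (1 : R^o) = incl I u by rewrite uE; exact: mulr1.
rewrite psiE /=; apply: Gu (phiP u); by rewrite uE.
Qed.

Lemma injective_ext0 N Q : injective_module Q -> ext_vanishes 0 N Q.
Proof.
move=> Qi f; have [ei ps epi] := hull_ses Q.
have [x ex0|r rE] := Qi _ _ (hull_emb Q) (idfun : {linear Q -> Q}).
  by rewrite /= (ei x 0) ?linear0 // ex0 linear0.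
have dL : linear (fun x => x - hull_emb Q (r x)).
  by move=> a x y; rewrite !linearP scalerDr addrACA.
have [x /epi[y <-] /=|h hE] := @factor_surj _ _ _ _ (hull_proj Q) (lin_of dL) ps.
  by rewrite rE subrr.
exists (h \o f) => x /=; have [y <-] := ps (f x).
by rewrite hE /= linearB (exact_comp0 epi) subr0.
Qed.

(** Dimension shifting in the second variable reduces to n = 0, where all cyclic
modules together force [Q] to be injective. *)
Lemma ext_baer n Q :
  (forall I : submodule R^o, ext_vanishes n (quotof I) Q) ->
  forall N, ext_vanishes n N Q.
Proof.
elim: n Q => [|n IH] Q H N; last exact: IH.
exact/injective_ext0/injective_of_ext.
Qed.

(** One step of a totally acyclic complex: [X] and [Y] are consecutive modules
of cycles, and maps from [X] to projectives extend, i.e. Ext^1(Y, Q) = 0.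
Being a proposition about modules only, it can be transported along equalities
of integer indices, which the maps of a complex indexed by int cannot. *)
Definition link X Y : Prop :=
  exists P (i : {linear X -> P}) (p : {linear P -> Y}),
    [/\ projective P, ses i p &
        forall Q, projective Q -> forall phi : {linear X -> Q},
          exists psi : {linear P -> Q}, forall x, psi (i x) = phi x].

Lemma link_iso_left X X' Y : iso X' X -> link X Y -> link X' Y.
Proof.
move=> [f [fi fs]] [P [i [p [Pp [ii ps ip] e]]]].
exists P, (i \o f), p; split=> //.
  split=> //; first exact: inj_comp.
  move=> v; split=> [/ip[x <-]|[x <-]]; last by apply/ip; exists (f x).
  by have [y <-] := fs x; exists y.
move=> Q Qp phi; have [g [fK gK]] := linear_inv fi fs.
have [psi psiE] := e Q Qp (phi \o g).
by exists psi => x; rewrite psiE /= fK.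
Qed.

Lemma link_right K P N (i : {linear K -> P}) (p : {linear P -> N}) :
  projective P -> ses i p ->
  (forall Q, projective Q -> ext_vanishes 0 N Q) -> link K N.
Proof.
move=> Pp s NQ; exists P, i, p; split=> // Q Qp phi.
exact: ext1_extend s (NQ Q Qp).
Qed.

Lemma link_ext0 X Y Q : projective Q -> link X Y -> ext_vanishes 0 Y Q.
Proof.
move=> Qp [P [i [p [Pp s e]]]]; apply: (ext1_of_extend s); last exact: e.
exact: ext_projective.
Qed.

Lemma link_extS n X Y Q : link X Y -> ext_vanishes n X Q -> ext_vanishes n.+1 Y Q.
Proof.
move=> [P [i [p [Pp s e]]]] XQ; apply: (ext_right s XQ).
exact: ext_projective.
Qed.

Definition chain (K : int -> lmodType R) := forall i : int, link (K i) (K (i + 1)).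

(** The differentials are P_i -> K_(i+1) -> P_(i+1). *)
Lemma gproj_of_chain N (K : int -> lmodType R) :
  chain K -> iso N (K 0) -> gorenstein_projective N.
Proof.
move=> LK NK.
(* The complex of the definition has [N] as its cycles in degree 0 + 1. *)
pose K1 i := K (i - 1).
have L i : link (K1 i) (K1 (i + 1)) by rewrite /K1 addrAC; exact: LK.
have {NK} : iso N (K1 (0 + 1)) by rewrite /K1 addrK.
move: K1 L => {LK}K L NK.
pose c i := cid (L i); pose P i := sval (c i).
pose c' i := cid (svalP (c i)); pose io i : {linear K i -> P i} := sval (c' i).
pose c'' i := cid (svalP (c' i)).
pose p i : {linear P i -> K (i + 1)} := sval (c'' i).
have H i : [/\ projective (P i), ses (io i) (p i) &
        forall Q, projective Q -> forall phi : {linear K i -> Q},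
          exists psi : {linear P i -> Q}, forall x, psi (io i x) = phi x].
  exact: svalP (c'' i).
clearbody P io p.
exists P, (fun i => io (i + 1) \o p i); split.
- by move=> i; case: (H i).
- move=> i v; have [_ [_ ps ip] _] := H i.
  have [_ [ii _ ip'] _] := H (i + 1); have [_ [ii'' _ _] _] := H (i + 1 + 1).
  split=> /= [e|[u <-]].
    have /ip'[x <-] : p (i + 1) v = 0 by apply: ii''; rewrite linear0.
    by have [u <-] := ps x; exists u.
  by rewrite (exact_comp0 ip') linear0.
- move=> Q Qp i u; have [_ [_ ps ip] _] := H i.
  have [_ [ii' ps' ip'] _] := H (i + 1); have [_ [ii'' _ _] e] := H (i + 1 + 1).
  split=> /= [u0|[w wE] x].
    have [x /ip'[y <-]|w wE] := @factor_surj _ _ _ _ (p (i + 1)) u ps'.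
      by have [z <-] := ps y.
    have [psi psiE] := e Q Qp w.
    by exists psi => x; rewrite psiE wE.
  by rewrite -wE (exact_comp0 ip') !linear0.
- have [f [fi fs]] := NK; exists (io (0 + 1) \o f).
  have [_ [_ ps _] _] := H 0; have [_ [ii _ _] _] := H (0 + 1).
  split; first exact: inj_comp.
  move=> y; split=> /= [[n <-]|[x <-]].
    by have [x xE] := ps (f n); exists x; rewrite xE.
  by have [n nE] := fs (p 0 x); exists n; rewrite nE.
Qed.

(** The cycles of the complex form the chain.  A map from the cycles in degree
l + 2 to Q, precomposed with the differential, is a cocycle on P_(l+1), and
the exactness of the dual complex extends it. *)
Lemma chain_of_gproj N : gorenstein_projective N ->
  exists2 K, chain K & iso N (K 0).
Proof.
move=> [P [d [Pp ex he [j [ji jE]]]]].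
pose K i : lmodType R := subof (ker (d i)).
have L l : link (K (l + 1 + 1)) (K (l + 1 + 1 + 1)).
  set i := l + 1 + 1.
  have pE k : exists p : {linear P k -> K (k + 1)}, forall x, incl _ (p x) = d k x.
    apply: factor_inj; first exact: incl_inj.
    by move=> x; apply: incl_surj; apply/(ex k); exists x.
  have [p0 p0E] := pE (l + 1); have [p pEi] := pE i.
  have ps k (q : {linear P k -> K (k + 1)}) : (forall x, incl _ (q x) = d k x) -> surj q.
    move=> qE y; have /(ex k)[x xE] := inclP y.
    by exists x; apply: incl_inj; rewrite qE.
  exists (P i), (incl _), p; split=> //.
    split; [exact: incl_inj|exact: ps|move=> v; split].
      by move=> pv; apply: incl_surj; rewrite /= -pEi pv linear0.
    by move=> [u <-]; apply: incl_inj; rewrite pEi (inclP u) linear0.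
  move=> Q Qp phi.
  have [+ _] := he Q Qp l (phi \o p0); case=> [x /=|w wE].
    rewrite (_ : p0 _ = 0) ?linear0 //; apply: incl_inj.
    by rewrite p0E linear0; apply/(ex l); exists x.
  exists w => x; have [y <-] := ps _ _ p0E x.
  by rewrite p0E wE.
exists (fun i => K (i + 1)).
  move=> i; have := L (i - 1); by rewrite subrK.
have [x|f fE] := @factor_inj _ _ _ _ (incl (ker (d (0 + 1)))) j (@incl_inj _ _ _).
  by apply: incl_surj; apply/(ex 0)/jE; exists x.
exists f; split.
  by move=> x y /(congr1 (incl _)); rewrite !fE => /ji.
move=> y; have /(ex 0)/jE[n nE] := inclP y.
by exists n; apply: incl_inj; rewrite fE.
Qed.

Lemma gproj_iso N N' : iso N N' -> gorenstein_projective N ->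
  gorenstein_projective N'.
Proof.
move=> /iso_sym i /chain_of_gproj[K LK NK].
exact: gproj_of_chain LK (iso_trans i NK).
Qed.

(** Shifting a chain gives again a chain, so the cokernel in the first step to
the right is Gorenstein projective as well. *)
Lemma gproj_link N : gorenstein_projective N ->
  exists2 Y, gorenstein_projective Y & link N Y.
Proof.
move=> /chain_of_gproj[K LK NK]; exists (K (0 + 1)); last exact: link_iso_left NK (LK 0).
apply: (@gproj_of_chain _ (fun i => K (i + 1))); last exact: iso_refl.
by move=> i; exact: LK.
Qed.

(** Each step of the chain raises the degree by one, and every module of the
chain has a predecessor. *)
Lemma gproj_ext n N Q : gorenstein_projective N -> projective Q ->
  ext_vanishes n N Q.
Proof.
move=> /chain_of_gproj[K LK /iso_sym NK] Qp; apply: ext_iso NK _.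
move: (0 : int); elim: n => [|n IH] i; rewrite -[i](subrK 1).
  exact: link_ext0 Qp (LK _).
exact: link_extS (LK _) (IH _).
Qed.

Lemma pair_projective P Q : projective P -> projective Q ->
  projective (P * Q)%type.
Proof.
move=> Pp Qp U V g f gs.
have [h1 h1E] := Pp _ _ g (f \o (@injl _ P Q)) gs.
have [h2 h2E] := Qp _ _ g (f \o (@injr _ P Q)) gs.
have hL : linear (fun x : (P * Q)%type => h1 x.1 + h2 x.2).
  by move=> a x y; rewrite !linearP scalerDr addrACA.
exists (lin_of hL) => -[x y]; rewrite /= linearD h1E h2E /= -linearD.
by congr (f _); congr pair; rewrite /= ?addr0 ?add0r.
Qed.

(** The contractible step 0 -> P -> P * P -> P -> 0. *)
Lemma projective_link P : projective P -> link P P.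
Proof.
move=> Pp.
have fL : linear (@fst P P) by [].
have sL : linear (@snd P P) by [].
exists (P * P)%type, (@injl _ P P), (lin_of sL); split.
- exact: pair_projective.
- split=> [x y []//|y|[x y]]; first by exists (0, y).
  by split=> /= [->|[u [_ ->]]//]; exists x.
- by move=> Q Qp phi; exists (phi \o lin_of fL) => x.
Qed.

Lemma projective_gproj P : projective P -> gorenstein_projective P.
Proof.
move=> Pp; apply: (@gproj_of_chain _ (fun=> P)); last exact: iso_refl.
by move=> _; exact: projective_link.
Qed.

Lemma pair_map_linear U V U' V' (f : {linear U -> V}) (f' : {linear U' -> V'}) :
  linear (fun x : (U * U')%type => (f x.1, f' x.2) : (V * V')%type).
Proof. by move=> a x y; rewrite !linearP. Qed.
Definition pair_map U V U' V' (f : {linear U -> V}) (f' : {linear U' -> V'}) :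
  {linear (U * U')%type -> (V * V')%type} := lin_of (pair_map_linear f f').

Lemma pair_ses K G N K' G' N' (i : {linear K -> G}) (p : {linear G -> N})
    (i' : {linear K' -> G'}) (p' : {linear G' -> N'}) :
  ses i p -> ses i' p' -> ses (pair_map i i') (pair_map p p').
Proof.
move=> [ii ps ip] [ii' ps' ip']; split.
- by move=> [x x'] [y y'] [/ii -> /ii' ->].
- move=> [y y']; have [x <-] := ps y; have [x' <-] := ps' y'.
  by exists (x, x').
- move=> [x x']; split=> [[/ip[z <-] /ip'[z' <-]]|[[z z'] [<- <-]]].
    by exists (z, z').
  by congr pair; rewrite /= ?(exact_comp0 ip) ?(exact_comp0 ip').
Qed.

Lemma pair_link X Y X' Y' : link X Y -> link X' Y' ->
  link (X * X')%type (Y * Y')%type.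
Proof.
move=> [P [i [p [Pp s e]]]] [P' [i' [p' [P'p s' e']]]].
exists (P * P')%type, (pair_map i i'), (pair_map p p'); split.
- exact: pair_projective.
- exact: pair_ses.
- move=> Q Qp phi.
  have [psi psiE] := e Q Qp (phi \o (@injl _ X X')).
  have [psi' psi'E] := e' Q Qp (phi \o (@injr _ X X')).
  have hL : linear (fun x : (P * P')%type => psi x.1 + psi' x.2).
    by move=> a x y; rewrite !linearP scalerDr addrACA.
  exists (lin_of hL) => -[x x']; rewrite /= psiE psi'E /= -linearD.
  by congr (phi _); congr pair; rewrite /= ?addr0 ?add0r.
Qed.

Lemma gproj_pair_projective N P : gorenstein_projective N -> projective P ->
  gorenstein_projective (N * P)%type.
Proof.
move=> /chain_of_gproj[K LK [f [fi fs]]] Pp.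
apply: (@gproj_of_chain _ (fun i => (K i * P)%type)).
  by move=> i; apply: pair_link => //; exact: projective_link.
exists (pair_map f (idfun : {linear P -> P})); split.
  by move=> [x x'] [y y'] [/fi -> ->].
by move=> [y y']; have [x <-] := fs y; exists (x, y').
Qed.

End Ext.

(** * Gorenstein projective dimension *)
Section GDim.
Variable R : comPzRingType.
Implicit Types U V W X K G N P Q J Y H Z : lmodType R.

(** Recursive form of the existence of a resolution of length [m], in which one
syzygy is split off at a time. *)
Fixpoint gdim_le (m : nat) N : Prop :=
  if m is m'.+1 then
    exists K G (i : {linear K -> G}) (p : {linear G -> N}),
      [/\ gorenstein_projective G, ses i p & gdim_le m' K]
  else gorenstein_projective N.

Lemma gdim_of_resolution m N : gproj_resolution N m -> gdim_le m N.
Proof.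
elim: m N => [|m IH] N [G [d [eps [Gp G0 es e0 eS]]]].
  apply: gproj_iso (Gp 0); exists eps; split=> //.
  by apply: lin_inj => x /e0[u <-]; rewrite (G0 1%N isT u) linear0.
exists (subof (ker eps)), (G 0), (incl (ker eps)), eps; split=> //.
  exact: ses_ker.
have [x|eps' eps'E] := @factor_inj _ _ _ _ (incl (ker eps)) (d 0) (@incl_inj _ _ _).
  by apply: incl_surj; apply/e0; exists x.
apply: IH; exists (fun i => G i.+1), (fun i => d i.+1), eps'; split=> //.
- by move=> i im; exact: G0.
- by move=> x; have /e0[y yE] := inclP x; exists y; apply: incl_inj; rewrite eps'E.
- move=> v; split=> [v0|/eS v0]; last by apply: incl_inj; rewrite eps'E v0 linear0.
  by apply/eS; rewrite -eps'E v0 linear0.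
Qed.

Lemma zero_linear U V : linear (fun _ : U => 0 : V).
Proof. by move=> a x y; rewrite scaler0 addr0. Qed.
Definition zero_map U V : {linear U -> V} := lin_of (@zero_linear U V).

Lemma trivial_projective P : (forall x : P, x = 0) -> projective P.
Proof.
move=> P0 U V g f _; exists (zero_map P U) => x.
by rewrite (P0 x) !linear0.
Qed.

Lemma resolution_of_gdim m N : gdim_le m N -> gproj_resolution N m.
Proof.
elim: m N => [|m IH] N.
  move=> Np; pose Z : lmodType R := 'rV[R]_0.
  have Z0 (x : Z) : x = 0 by apply/rowP => -[].
  exists (fun i => if i is 0 then N else Z).
  exists (fun i => zero_map Z (if i is 0 then N else Z)), idfun; split.
  - by case=> // _; apply/projective_gproj/trivial_projective.
  - by case.
  - by move=> x; exists x.
  - by move=> v; split=> [/= ->|[u <-]//]; exists 0.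
  - by move=> i v; split=> [_|_]; [exists 0; rewrite (Z0 v)|rewrite (Z0 v) linear0].
move=> [K [H [i [p [Hp [ii ps ip] /IH[G [d [eps [Gp G0 es e0 eS]]]]]]]]].
pose G' j : lmodType R := if j is j'.+1 then G j' else H.
pose d' j : {linear G' j.+1 -> G' j} :=
  match j return {linear G' j.+1 -> G' j} with 0 => i \o eps | j'.+1 => d j' end.
exists G', d', p; split=> //.
- by case=> [|j]; [exact: Hp|exact: Gp].
- by case=> // j jm; exact: G0.
- move=> v; split=> [/ip[x <-]|[u <-]]; first by have [u <-] := es x; exists u.
  by rewrite /= (exact_comp0 ip).
- case=> [|j]; last exact: eS.
  move=> v; split=> [/= e|/e0 v0]; last by rewrite /= v0 linear0.
  by apply/e0/ii; rewrite e linear0.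
Qed.

Lemma Gpd_leP N d : Gpd_le N d <-> exists m : nat, m%:Z <= d /\ gdim_le m N.
Proof.
by split=> -[m [md H]]; exists m; split=> //;
  [exact: gdim_of_resolution|exact: resolution_of_gdim].
Qed.

Lemma gdim_iso m N N' : iso N N' -> gdim_le m N -> gdim_le m N'.
Proof.
case: m => [|m]; first exact: gproj_iso.
move=> [f [fi fs]] [K [G [i [p [Gp [ii ps ip] Km]]]]].
exists K, G, i, (f \o p); split=> //; split=> //.
  by move=> y; have [x <-] := fs y; have [z <-] := ps x; exists z.
move=> v; rewrite -ip; split=> /= [|->]; last exact: linear0.
by rewrite -[X in _ = X](linear0 f) => /fi.
Qed.

Lemma gdim_ext m n N Q : gdim_le m N -> projective Q -> (m <= n)%N ->
  ext_vanishes n N Q.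
Proof.
move=> + Qp; elim: m n N => [|m IH] n N; first by move=> Np _; exact: gproj_ext.
case: n => // n [K [G [i [p [Gp s Km]]]]] mn.
by apply: (ext_right s); [exact: IH|exact: gproj_ext].
Qed.

Lemma gproj_cover G : gorenstein_projective G ->
  exists P (p : {linear P -> G}), projective P /\ surj p.
Proof.
move=> /chain_of_gproj[K LK /iso_sym[f [fi fs]]].
have := LK (-1); rewrite addNr => -[P [i [p [Pp [_ ps _] _]]]].
exists P, (f \o p); split=> // y.
by have [x <-] := fs y; have [z <-] := ps x; exists z.
Qed.

Lemma gdim_cover m N : gdim_le m N ->
  exists P (p : {linear P -> N}), projective P /\ surj p.
Proof.
case: m => [|m]; first exact: gproj_cover.
move=> [K [G [i [p [/gproj_cover[P [q [Pp qs]]] [_ ps _] _]]]]].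
exists P, (p \o q); split=> // y.
by have [x <-] := ps y; have [z <-] := qs x; exists z.
Qed.

Lemma gdim_pair_projective m N P : gdim_le m N -> projective P ->
  gdim_le m (N * P)%type.
Proof.
case: m => [|m]; first exact: gproj_pair_projective.
move=> [K [G [i [p [Gp [ii ps ip] Km]]]]] Pp.
have iL : linear (fun x : K => (i x, 0) : (G * P)%type).
  by move=> a x y; rewrite linearP; congr pair; rewrite /= scaler0 addr0.
exists K, (G * P)%type, (lin_of iL), (pair_map p (idfun : {linear P -> P})).
split=> //; first exact: gproj_pair_projective.
split.
- by move=> x y [/ii].
- by move=> [y y']; have [x <-] := ps y; exists (x, y').
- move=> [x x']; split=> [[/ip[z <-] /= ->]|[z [<- <-]]]; first by exists z.
  by rewrite /= (exact_comp0 ip).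
Qed.

Section EnoughProjectives.
Hypothesis enough_projectives :
  forall N, exists P (p : {linear P -> N}), projective P /\ surj p.

(** The class of modules left orthogonal to all projectives; over a ring of
finite Gorenstein global dimension it turns out to consist of the Gorenstein
projective modules. *)
Definition perp N : Prop := forall n Q, projective Q -> ext_vanishes n N Q.

Lemma gproj_perp N : gorenstein_projective N -> perp N.
Proof. by move=> Np n Q Qp; exact: gproj_ext. Qed.

Lemma perp_syzygy X : perp X -> exists2 Z, perp Z & link Z X.
Proof.
move=> Xp; have [P [p [Pp ps]]] := enough_projectives X.
exists (subof (ker p)).
  move=> n Q Qp; apply: (ext_left (ses_ker ps)); first exact: Xp.
  exact: ext_projective.
by apply: (link_right Pp (ses_ker ps)) => Q; exact: (Xp 0%N).
Qed.

(** A chain through [X] is built by dependent choice: to the right inside [C], to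
the left by syzygies, which stay orthogonal to projectives. *)
Lemma gproj_of_class (C : lmodType R -> Prop) :
  (forall X, C X -> perp X) ->
  (forall X, C X -> exists2 Y, C Y & link X Y) ->
  forall X, C X -> gorenstein_projective X.
Proof.
move=> Cp Cl X CX.
have Cl' (x : {X | C X}) : {y : {X | C X} | link (sval x) (sval y)}.
  by case: x => x Cx; have [y Cy xy] := cid2 (Cl x Cx); exists (exist _ y Cy).
have Pl (x : {X | perp X}) : {y : {X | perp X} | link (sval y) (sval x)}.
  by case: x => x Cx; have [y Cy xy] := cid2 (perp_syzygy Cx); exists (exist _ y Cy).
pose r n := iter n (fun x => sval (Cl' x)) (exist _ X CX).
pose l n := iter n (fun x => sval (Pl x)) (exist _ X (Cp _ CX)).
pose K (i : int) : lmodType R :=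
  match i with Posz n => sval (r n) | Negz n => sval (l n.+1) end.
apply: (@gproj_of_chain _ _ K); last exact: iso_refl.
case=> n.
  have -> : n%:Z + 1 = n.+1 by rewrite -addn1 PoszD.
  exact: svalP (Cl' (r n)).
have := svalP (Pl (l n)); case: n => [|n] H; first exact: H.
have -> : Negz n.+1 + 1 = Negz n by rewrite !NegzE -addn1 PoszD opprD addrNK.
exact: H.
Qed.

Lemma gproj_extension G X H (i : {linear G -> X}) (p : {linear X -> H}) :
  ses i p -> gorenstein_projective G -> gorenstein_projective H ->
  gorenstein_projective X.
Proof.
move=> s Gp Hp.
(* The class of all such extensions is closed under steps to the right: embed
   G and H in P and P', extend the first embedding e to X, and embed X in
   P * P' by (e, j' p); the cokernel is an extension of the two cokernels. *)
pose C X := exists G H (i : {linear G -> X}) (p : {linear X -> H}),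
  [/\ ses i p, gorenstein_projective G & gorenstein_projective H].
apply: (@gproj_of_class C); last by exists G, H, i, p.
  move=> {}X [{}G [{}H [{}i [{}p [{}s {}Gp {}Hp]]]]] n Q Qp.
  by apply: (ext_middle s); exact: gproj_ext.
move=> {}X [{}G [{}H [{}i [{}p [{}s {}Gp {}Hp]]]]].
have [G1 G1p [P [j [q [Pp sq _]]]]] := gproj_link Gp.
have [H1 H1p [P' [j' [q' [P'p sq' _]]]]] := gproj_link Hp.
have [e eE] := ext1_extend j s (gproj_ext 0 Hp Pp).
have [ii ps ip] := s; have [ji qs jq] := sq; have [j'i q's jq'] := sq'.
have kL : linear (fun x => (e x, j' (p x)) : (P * P')%type).
  by move=> a x y; rewrite !linearP.
pose k := lin_of kL.
have ki : injective k.
  apply: lin_inj => x [ex px].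
  have /ip[g gx] : p x = 0 by apply: j'i; rewrite linear0.
  have : j g = 0 by rewrite -eE gx.
  by rewrite -(linear0 j) => /ji g0; rewrite -gx g0 linear0.
pose Y := quotof (im k).
have CY : C Y.
  have sL : linear (@snd P P') by [].
  have [x|u uE] := @factor_surj _ _ _ _ q (proj (im k) \o (@injl _ P P')) qs.
    move=> /jq[g gx]; rewrite /=; apply/proj_eq0; exists (i g).
    by rewrite /k /= eE gx (exact_comp0 ip) linear0.
  have [x|v vE] := @factor_surj _ _ _ _ (proj (im k)) (q' \o lin_of sL) (@proj_surj _ _ _).
    by move/proj_eq0=> [z <-] /=; rewrite (exact_comp0 jq').
  exists G1, H1, u, v; split=> //; split.
  - apply: lin_inj => y; have [x <-] := qs y; rewrite uE /=.
    move/proj_eq0=> [z [ez pz]].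
    have /ip[g gz] : p z = 0 by apply: j'i; rewrite pz linear0.
    by rewrite -ez -gz eE (exact_comp0 jq).
  - by move=> y; have [x <-] := q's y; exists (proj (im k) (0, x)); rewrite vE.
  - move=> y; have [[x1 x2] <-] := proj_surj y; rewrite vE /=; split.
      move=> /jq'[h hx2]; have [z zh] := ps h.
      exists (q (x1 - e z)); rewrite uE /=; apply/subr0_eq; rewrite -linearB.
      apply/proj_eq0; exists (- z).
      rewrite /k /= !linearN zh hx2; congr pair => /=; last by rewrite sub0r.
      by rewrite addrAC subrr sub0r.
    move=> [z zE]; have [x xz] := qs z; rewrite -xz uE in zE.
    by rewrite -[q' x2]/((q' \o lin_of sL) (x1, x2)) -vE -zE vE /= linear0.
exists Y => //; apply: (@link_right _ _ (P * P')%type _ k (proj (im k))).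
- exact: pair_projective.
- exact: ses_coker.
- move=> Q Qp; case: CY => [G' [H' [i' [p' [s' G'p H'p]]]]].
  by apply: (ext_middle s'); exact: gproj_ext.
Qed.

(** Let j : K -> P be the first step to the right of [K], with Gorenstein
projective cokernel K1.  As Ext^1(N, P) = 0, j extends to e : G -> P, and
(e, p) embeds [G] in P * N with cokernel K1.  Hence P * N is Gorenstein
projective and embeds in a projective P2 with Gorenstein projective cokernel Y.
Then P2 / N is an extension of Y by P, so [N] has a step to the right whose
cokernel is Gorenstein projective.  This replaces the closure of the Gorenstein
projective modules under direct summands, whose proof needs infinite sums. *)
Lemma gproj_perp_quotient K G N (i : {linear K -> G}) (p : {linear G -> N}) :
  ses i p -> gorenstein_projective K -> gorenstein_projective G -> perp N ->
  gorenstein_projective N.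
Proof.
move=> s Kp Gp Np.
have [K1 K1p [P [j [q [Pp sq _]]]]] := gproj_link Kp.
have [e eE] := ext1_extend j s (Np 0%N _ Pp).
have [ii ps ip] := s; have [ji qs jq] := sq.
pose X : lmodType R := (P * N)%type.
have Xp : gorenstein_projective X.
  have kL : linear (fun x => (e x, p x) : X) by move=> a x y; rewrite !linearP.
  have [x|u uE] := @factor_surj _ _ _ _ p (q \o e) ps.
    by move/ip=> [y <-] /=; rewrite eE (exact_comp0 jq).
  have vL : linear (fun x : X => q x.1 - u x.2).
    by move=> a x y; rewrite !linearP scalerDr addrACA.
  apply: (@gproj_extension G X K1 (lin_of kL) (lin_of vL)) => //; split.
  - apply: lin_inj => x [ex /ip[y yx]]; rewrite -yx.
    have : j y = 0 by rewrite -eE yx.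
    by rewrite -(linear0 j) => /ji ->; rewrite linear0.
  - by move=> y; have [x <-] := qs y; exists (x, 0); rewrite /= linear0 subr0.
  - move=> [x y]; have [z <-] := ps y; rewrite /= uE /= -linearB; split.
      move/jq=> [w wE]; exists (z + i w).
      by rewrite !linearD eE wE (exact_comp0 ip) addr0 addrCA subrr addr0.
    move=> [w [<- /eqP]]; rewrite -subr_eq0 -linearB => /eqP/ip[v vE].
    by rewrite -linearB -vE eE (exact_comp0 jq).
have [Y Yp [P2 [k [r [P2p [ki rs kr] _]]]]] := gproj_link Xp.
pose b := k \o (@injr _ P N).
have bi : injective b by move=> x y /ki[].
pose Z := quotof (im b).
have Zp : gorenstein_projective Z.
  have [x|v vE] := @factor_surj _ _ _ _ (proj (im b)) r (@proj_surj _ _ _).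
    by move/proj_eq0=> [y <-]; rewrite (exact_comp0 kr).
  apply: (@gproj_extension P Z Y (proj (im b) \o (k \o (@injl _ P N))) v) => //.
    split.
    - by apply: lin_inj => x /= /proj_eq0[y /ki[]].
    - by move=> y; have [x <-] := rs y; exists (proj (im b) x).
    - move=> z; have [x <-] := proj_surj z; rewrite vE; split.
        move/kr=> [[x1 x2] <-]; exists x1 => /=; apply/subr0_eq; rewrite -linearB.
        apply/proj_eq0; exists (- x2); rewrite /= -linearB; congr (k _).
        by congr pair; rewrite /= ?subrr ?sub0r.
      by move=> [y /= yE]; rewrite -vE -yE vE (exact_comp0 kr).
  exact: projective_gproj.
pose C N := perp N /\ exists2 Y, gorenstein_projective Y & link N Y.
apply: (@gproj_of_class C); first by move=> ? [].
  move=> V [_ [W Wp VW]]; exists W => //; split; first exact: gproj_perp.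
  exact: gproj_link.
split=> //; exists Z => //.
apply: (link_right P2p (ses_coker bi)) => Q Qp; exact: gproj_ext.
Qed.

(** Orthogonality passes to the syzygies of a Gorenstein projective resolution,
which can therefore be shortened one step after the other. *)
Lemma perp_gdim m N : gdim_le m N -> perp N -> gorenstein_projective N.
Proof.
elim: m N => [|m IH] N //; move=> [K [G [i [p [Gp s Km]]]]] Np.
apply: (gproj_perp_quotient s) => //; apply: IH => // n Q Qp.
by apply: (ext_left s); [exact: Np|exact: gproj_ext].
Qed.

End EnoughProjectives.

(** The hypothesis on all modules also provides enough projectives, since a
Gorenstein projective module is a quotient of a projective one. *)
Lemma gdim_of_ext j N : (forall N, exists m, gdim_le m N) ->
  (forall n Q, (j <= n)%N -> projective Q -> ext_vanishes n N Q) -> gdim_le j N.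
Proof.
move=> fin.
have enough V : exists P (p : {linear P -> V}), projective P /\ surj p.
  by have [m /gdim_cover] := fin V.
elim: j N => [|j IH] N H.
  by have [m Nm] := fin N; apply: (perp_gdim enough Nm) => n Q; exact: H.
have [P [p [Pp ps]]] := enough N.
exists (subof (ker p)), P, (incl _), p; split.
- exact: projective_gproj.
- exact: ses_ker.
- apply: IH => n Q jn Qp; apply: (ext_left (ses_ker ps)); first exact: H.
  exact: ext_projective.
Qed.

(** The Gorenstein analogue of Auslander's theorem that the global dimension is
determined by the cyclic modules. *)
Lemma gdim_from_cyclic j : (forall N, exists m, gdim_le m N) ->
  (forall I : submodule R^o, exists2 m, (m <= j)%N & gdim_le m (quotof I)) ->
  forall N, gdim_le j N.
Proof.
move=> fin cyc N; apply: gdim_of_ext => // n Q jn Qp; apply: ext_baer => I.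
have [m mj Im] := cyc I; apply: gdim_ext Im Qp _; exact: leq_trans jn.
Qed.

End GDim.

(** * Finitely generated modules and stable retracts *)
Section FinitelyGenerated.
Variable R : comPzRingType.
Implicit Types U V W X K G N P Q J Y H Z F : lmodType R.

Lemma comb_linear n V (u : 'I_n -> V) :
  linear (fun x : 'rV[R]_n => \sum_i x 0 i *: u i).
Proof.
move=> a x y; rewrite scaler_sumr -big_split; apply: eq_bigr => i _ /=.
by rewrite !mxE scalerDl scalerA.
Qed.
Definition comb n V (u : 'I_n -> V) : {linear 'rV[R]_n -> V} :=
  lin_of (@comb_linear n V u).

Lemma row_comb n V (f : {linear 'rV[R]_n -> V}) x :
  f x = \sum_i x 0 i *: f (delta_mx 0 i).
Proof.
rewrite {1}[x]row_sum_delta linear_sum; apply: eq_bigr => i _.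
by rewrite linearZ.
Qed.

Lemma row_projective n : projective ('rV[R]_n : lmodType R).
Proof.
move=> U V g f gs; have [u uE] := choice (fun i => gs (f (delta_mx 0 i))).
exists (comb u) => x; rewrite /= linear_sum row_comb.
by apply: eq_bigr => i _; rewrite linearZ /= uE.
Qed.

Lemma projective_iso P P' : iso P P' -> projective P -> projective P'.
Proof.
move=> [f [fi fs]] Pp U V g h gs; have [f' [fK f'K]] := linear_inv fi fs.
have [k kE] := Pp _ _ g (h \o f) gs.
by exists (k \o f') => x; rewrite /= kE /= f'K.
Qed.

Lemma fg_free_iso F : fg_free F -> exists n, iso ('rV[R]_n : lmodType R) F.
Proof.
move=> [n [f [g fK gK]]]; exists n, f.
by split; [exact: can_inj fK|move=> y; exists (g y)].
Qed.

Lemma fg_free_projective F : fg_free F -> projective F.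
Proof. by move=> /fg_free_iso[n /projective_iso]; apply; exact: row_projective. Qed.

Lemma iso_fg_free n F : iso ('rV[R]_n : lmodType R) F -> fg_free F.
Proof.
move=> [f [fi fs]]; have [g [fK gK]] := linear_inv fi fs.
by exists n, f; exists g.
Qed.

Lemma row_fg_free n : fg_free ('rV[R]_n : lmodType R).
Proof. by apply: (@iso_fg_free n); exact: iso_refl. Qed.

Lemma regular_fg_free : fg_free (R^o : lmodType R).
Proof.
have fL : linear (fun x : 'rV[R]_1 => x 0 0 : R^o) by move=> a x y; rewrite !mxE.
exists 1%N, (lin_of fL); exists (fun a => const_mx a) => x /=.
  by apply/rowP => i; rewrite mxE ord1.
by rewrite mxE.
Qed.

Definition fin_gen N := exists n (q : {linear 'rV[R]_n -> N}), surj q.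

Lemma fg_free_fin_gen F : fg_free F -> fin_gen F.
Proof. by move=> /fg_free_iso[n [f [_ fs]]]; exists n, f. Qed.

Lemma fin_gen_image U V (f : {linear U -> V}) : surj f -> fin_gen U -> fin_gen V.
Proof.
move=> fs [n [q qs]]; exists n, (f \o q) => v.
by have [u <-] := fs v; have [x <-] := qs u; exists x.
Qed.

Lemma fin_gen_sum U V W (a : {linear U -> W}) (b : {linear V -> W}) :
  (forall w, exists u v, w = a u + b v) -> fin_gen U -> fin_gen V -> fin_gen W.
Proof.
move=> ab [m [p ps]] [n [q qs]].
have fL : linear (fun x : 'rV[R]_(m + n) => a (p (lsubmx x)) + b (q (rsubmx x))).
  by move=> c x y; rewrite !linearP scalerDr addrACA.
exists (m + n)%N, (lin_of fL) => w; have [u [v ->]] := ab w.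
have [x <-] := ps u; have [y <-] := qs v.
by exists (row_mx x y); rewrite /= row_mxKl row_mxKr.
Qed.

Lemma fin_gen_ideal (I : submodule R^o) : fin_gen (subof I) -> fg_ideal I.
Proof.
move=> [n [q qs]]; exists n, (fun i => incl I (q (delta_mx 0 i))) => x.
have qE c : incl I (q c) = \sum_i c 0 i *: incl I (q (delta_mx 0 i)).
  by rewrite -[LHS]/((incl I \o q) c) row_comb.
split=> [/incl_surj[y <-]|[c ->]].
  by have [c <-] := qs y; exists (fun i => c 0 i); rewrite qE.
rewrite (_ : \sum_i _ = incl I (q (\row_i c i))); first exact: inclP.
by rewrite qE; apply: eq_bigr => i _; rewrite mxE.
Qed.

Lemma mulmap_linear (a : R) : linear (fun x : R^o => a * x : R^o).
Proof. by move=> b x y; rewrite mulrDr mulrCA. Qed.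
Definition mulmap (a : R) : {linear R^o -> R^o} := lin_of (mulmap_linear a).

Lemma regular_linear V (f : {linear R^o -> V}) (x : R) : f x = x *: f 1.
Proof. by rewrite -linearZ /= -[_ *: _]/(_ * _) mulr1. Qed.

(** [N] is a retract of [N'] up to maps that factor through a finitely generated
free module.  This is what syzygies of one module taken along two different
presentations have in common, and what is used of Schanuel's lemma. *)
Definition stable_retract N N' := exists (i : {linear N -> N'})
  (r : {linear N' -> N}) (m : nat) (u : {linear N -> 'rV[R]_m})
  (v : {linear 'rV[R]_m -> N}), forall x, r (i x) + v (u x) = x.

Lemma stable_retract_refl N : stable_retract N N.
Proof.
exists idfun, idfun, 0%N, (zero_map _ _), (zero_map _ _) => x.
by rewrite /= addr0.
Qed.

Lemma stable_retract_fin_gen N N' : stable_retract N N' -> fin_gen N' -> fin_gen N.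
Proof.
move=> [i [r [m [u [v E]]]]] N'fg.
apply: (@fin_gen_sum _ _ _ r v) => // [x|].
  by exists (i x), (u x); rewrite E.
exact/fg_free_fin_gen/row_fg_free.
Qed.

(** Lift the retraction data to f : R^a -> P', g : P' -> R^a and w : R^m -> R^a.
The defect 1 - g f - w u p has its image in ker p, and on ker p it is 1 - g f,
which thus factors through R^a. *)
Lemma stable_retract_ker a N N' P' (p : {linear 'rV[R]_a -> N})
    (p' : {linear P' -> N'}) :
  projective P' -> surj p -> surj p' -> stable_retract N N' ->
  stable_retract (subof (ker p)) (subof (ker p')).
Proof.
move=> P'p ps p's [i [r [m [u [v E]]]]].
have [f fE] := @row_projective a _ _ p' (i \o p) p's.
have [g gE] := P'p _ _ p (r \o p') ps.
have [w wE] := @row_projective m _ _ p v ps.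
have hL : linear (fun x => x - (g (f x) + w (u (p x)))).
  by move=> c x y; rewrite !linearP addrACA -scalerDr opprD -scalerN addrACA -scalerDr.
have [x|h hE] := @factor_inj _ _ _ _ (incl (ker p)) (lin_of hL) (@incl_inj _ _ _).
  by apply: incl_surj; rewrite /= linearB linearD gE wE /= fE /= E subrr.
have [x|f' f'E] := @factor_inj _ _ _ _ (incl (ker p')) (f \o incl (ker p)) (@incl_inj _ _ _).
  by apply: incl_surj; rewrite /= fE /= (inclP x) linear0.
have [x|g' g'E] := @factor_inj _ _ _ _ (incl (ker p)) (g \o incl (ker p')) (@incl_inj _ _ _).
  by apply: incl_surj; rewrite /= gE /= (inclP x) linear0.
exists f', g', a, (incl (ker p)), h => x; apply: incl_inj.
rewrite linearD g'E hE /= f'E /= (inclP x : p _ = 0) !linear0 addr0.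
by rewrite addrCA subrr addr0.
Qed.

End FinitelyGenerated.

(** * Rings in which an element of square zero spans a summand of its annihilator *)
Section Socle.
Variable R : comPzRingType.
Implicit Types U V W X K G N P Q J Y H Z F : lmodType R.

(** [rho] is a linear retraction of the ideal m = ann s onto s R, encoded as a
function on [R] constrained only on m, which spares a type for m. *)
Record socle_retraction (s : R) (rho : R -> R) : Prop := {
  socle_sq0 : s * s = 0;
  socle_add : forall x y, s * x = 0 -> s * y = 0 -> rho (x + y) = rho x + rho y;
  socle_mul : forall a x, s * x = 0 -> rho (a * x) = a * rho x;
  socle_im : forall x, s * x = 0 -> exists t, rho x = s * t;
  socle_id : rho s = s }.

Variables (s : R) (rho : R -> R).
Hypothesis sr : socle_retraction s rho.

Lemma retraction_mul t : rho (s * t) = s * t.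
Proof. by rewrite mulrC (socle_mul sr) ?(socle_id sr) // (socle_sq0 sr). Qed.

Lemma retraction_linear X (f : {linear X -> R^o}) : (forall x, s * f x = 0) ->
  linear (fun x => rho (f x) : R^o).
Proof.
move=> sf a x y; rewrite linearP (socle_add sr) ?(socle_mul sr) //.
by rewrite mulrCA sf mulr0.
Qed.

(** With k = s R and m = ann s, the syzygies of R / b R are b R and then k, whose
syzygy is m, and k is a summand of m.  So the vanishing of some Ext^n(k, R)
descends to n = 1, where it makes [rho] a multiplication. *)
Lemma not_G_ring_2 (b : R) :
  (forall x, b * x = 0 <-> exists t, x = s * t) ->
  (forall t, ~ forall x, s * x = 0 -> rho x = t * x) ->
  forall d : nat, ~ G_ring R 2 d.
Proof.
move=> bs nrho d GR.
pose N0 : lmodType R := quotof (im (mulmap b)).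
have /GR/Gpd_leP[m [_ Nm]] : n_presented 2 N0.
  exists (fun=> R^o : lmodType R).
  exists (fun i => if i is 0 then mulmap b else mulmap s), (proj (im (mulmap b))).
  split=> [i _|||[|//] _ v].
  - exact: regular_fg_free.
  - exact: proj_surj.
  - by move=> _ v; exact: proj_eq0.
  - by rewrite /= bs; split=> -[t]; [move=> ->|move=> <-]; exists t.
have Rp : projective (R^o : lmodType R) by apply: fg_free_projective; exact: regular_fg_free.
pose N1 : lmodType R := subof (im (mulmap b)).
have s0 : ses (incl (im (mulmap b))) (proj (im (mulmap b))).
  split; [exact: incl_inj|exact: proj_surj|move=> v; split].
    by move/proj_eq0/incl_surj.
  by move=> [x <-]; apply/proj_eq0; exact: inclP.
have [x|p1 p1E] := @factor_inj _ _ _ _ (incl (im (mulmap b))) (mulmap b) (@incl_inj _ _ _).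
  by apply: incl_surj; exists x.
have p1s : surj p1.
  by move=> y; have [x xE] := inclP y; exists x; apply: incl_inj; rewrite p1E.
pose k : lmodType R := subof (ker p1).
have kP x : (exists t, x = s * t) <-> p1 x = 0.
  rewrite -bs; split=> [e|e]; first by apply: incl_inj; rewrite p1E linear0.
  by rewrite -[LHS]/(mulmap b x) -p1E e linear0.
have [x|p2 p2E] := @factor_inj _ _ _ _ (incl (ker p1)) (mulmap s) (@incl_inj _ _ _).
  by apply: incl_surj; apply/kP; exists x.
have p2s : surj p2.
  move=> y; have /kP[x xE] := inclP y; exists x; apply: incl_inj.
  by rewrite p2E xE.
pose mm : lmodType R := subof (ker p2).
have mmP x : s * x = 0 <-> p2 x = 0.
  split=> e; first by apply: incl_inj; rewrite p2E linear0.
  by rewrite -[LHS]/(mulmap s x) -p2E e linear0.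
have sm (x : mm) : s * incl (ker p2) x = 0 by apply/mmP; exact: (inclP x).
have [x|r rE] := @factor_inj _ _ _ _ (incl (ker p1)) (lin_of (retraction_linear sm)) (@incl_inj _ _ _).
  by apply: incl_surj; apply/kP; exact: (socle_im sr).
have [x|i iE] := @factor_inj _ _ _ _ (incl (ker p2)) (incl (ker p1)) (@incl_inj _ _ _).
  have /kP[t ->] := inclP x; apply: incl_surj; apply/mmP.
  by rewrite mulrA (socle_sq0 sr) mul0r.
have ri x : r (i x) = x.
  apply: incl_inj; rewrite rE /= iE; have /kP[t ->] := inclP x.
  exact: retraction_mul.
have kstep n : ext_vanishes n.+1 k (R^o : lmodType R) ->
    ext_vanishes n k (R^o : lmodType R).
  move=> kn; apply: (ext_retract ri); apply: (ext_left (ses_ker p2s) kn).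
  exact: ext_projective.
have km : ext_vanishes m k (R^o : lmodType R).
  have H : ext_vanishes m.+2 N0 (R^o : lmodType R).
    by apply: (gdim_ext Nm) => //; rewrite leqW.
  apply: (ext_left (ses_ker p1s)); last exact: ext_projective.
  by apply: (ext_left s0 H); exact: ext_projective.
have {km} k0 : ext_vanishes 0 k (R^o : lmodType R) by elim: m km {Nm} => // n IH /kstep.
have [psi psiE] := ext1_extend (lin_of (retraction_linear sm)) (ses_ker p2s) k0.
apply: (nrho (psi 1)) => x /mmP sx.
have [y yE] := @incl_surj _ _ (ker p2) x sx.
by rewrite -yE; have := psiE y; rewrite /= => <-; rewrite regular_linear mulrC.
Qed.

Hypothesis s_unit : forall x, s * x <> 0 -> exists y, x * y = 1.

(** If some kernel element has a coordinate that is a unit, the corresponding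
generator is a combination of the others, and the cover was not minimal. *)
Lemma minimal_cover N : fin_gen N ->
  exists n (q : {linear 'rV[R]_n -> N}), surj q /\
    forall x, q x = 0 -> forall i, s * x 0 i = 0.
Proof.
move=> [n0 n0P].
have ex : exists n, `[< exists q : {linear 'rV[R]_n -> N}, surj q >].
  by exists n0; apply/asboolP.
case: (ex_minnP ex) => n /asboolP[q qs] nmin; exists n, q; split=> // x qx i.
apply: contrapT => /s_unit[y xy].
case: n i q qs nmin x qx xy => [[]//|n] i q qs nmin x qx xy.
have insL : linear (fun w : 'rV[R]_n =>
    \row_k (if unlift i k is Some j then w 0 j else 0) : 'rV[R]_n.+1).
  move=> a v w; apply/rowP => k; rewrite !mxE.
  by case: unlift => [j|]; rewrite ?mxE // mulr0 addr0.
suff /nmin : `[< exists q : {linear 'rV[R]_n -> N}, surj q >] by rewrite ltnn.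
apply/asboolP; exists (q \o lin_of insL) => v; have [z <-] := qs v.
pose z' := z - (z 0 i * y) *: x.
exists (\row_j z' 0 (lift i j)).
have -> : q z = q z' by rewrite linearB linearZ /= qx scaler0 subr0.
congr (q _); apply/rowP => k; rewrite mxE; case: unliftP => [j ->|->].
  by rewrite mxE.
by rewrite !mxE -mulrA (mulrC y) xy mulr1 subrr.
Qed.

(** Notation of the proof: K0 = ker q0 and K1 = ker q1 are the minimal syzygies,
ker eps and ker p1 the given ones.  If K1 sits in R^(b+1), the maps
io : t |-> s t e_0 and pr = rho of the 0-th coordinate exhibit s R as a summand
of K1, hence of ker p1 by the stable retraction [i], [r].  From the finite
presentation of ker p1, finitely many generators of m are then extracted. *)
Lemma three_presented_projective N :
  ~ fg_ideal (fun x => s * x = 0) -> n_presented 3 N -> projective N.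
Proof.
move=> nfg [F [d [eps [Ff es /(_ isT) e0 eS]]]].
have ex1 := eS 0%N isT; have ex2 := eS 1%N isT.
have Fp i : (i <= 3)%N -> projective (F i) by move=> /Ff/fg_free_projective.
have Fg i : (i <= 3)%N -> fin_gen (F i) by move=> /Ff/fg_free_fin_gen.
have [a [q0 [q0s q0m]]] := minimal_cover (fin_gen_image es (Fg 0%N isT)).
have [x|p1 p1E] := @factor_inj _ _ _ _ (incl (ker eps)) (d 0) (@incl_inj _ _ _).
  by apply: incl_surj; apply/e0; exists x.
have p1s : surj p1.
  move=> y; have /e0[x xE] := inclP y; exists x.
  by apply: incl_inj; rewrite p1E.
have p10 x : p1 x = 0 <-> d 0 x = 0.
  rewrite -p1E; split=> [->|e]; first exact: linear0.
  by apply: incl_inj; rewrite e linear0.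
have [x|p2 p2E] := @factor_inj _ _ _ _ (incl (ker p1)) (d 1) (@incl_inj _ _ _).
  by apply: incl_surj; apply/p10/ex1; exists x.
have p2s : surj p2.
  move=> y; have /p10/ex1[x xE] := inclP y; exists x.
  by apply: incl_inj; rewrite p2E.
have p20 x : p2 x = 0 <-> d 1 x = 0.
  rewrite -p2E; split=> [->|e]; first exact: linear0.
  by apply: incl_inj; rewrite e linear0.
have sr0 := stable_retract_ker (Fp 0%N isT) q0s es (stable_retract_refl N).
have K0g := stable_retract_fin_gen sr0 (fin_gen_image p1s (Fg 1%N isT)).
have [b [q1 [q1s q1m]]] := minimal_cover K0g.
have [i [r [m [u [v iruv]]]]] := stable_retract_ker (Fp 1%N isT) q1s p1s sr0.
case: b => [|b] in q1 q1s q1m i r u v iruv *.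
  apply: (projective_iso _ (@row_projective R a)); exists q0; split=> //.
  apply: lin_inj => x qx; have [y <-] := @incl_surj _ _ (ker q0) x qx.
  have [z <-] := q1s y.
  by rewrite (_ : z = 0) ?linear0 //; apply/rowP => -[].
case: (nfg).
have ioL : linear (fun t : R^o => (s * t) *: delta_mx 0 0 : 'rV[R]_b.+1).
  by move=> c x y; rewrite mulrDr scalerDl mulrCA scalerA.
have [t|io ioE] := @factor_inj _ _ _ _ (incl (ker q1)) (lin_of ioL) (@incl_inj _ _ _).
  apply: incl_surj; rewrite /= mulrC -scalerA linearZ /=.
  rewrite (_ : q1 _ = 0) ?scaler0 //; apply: incl_inj; rewrite linearZ linearZ /=.
  rewrite linear0; apply/rowP => j; rewrite !mxE.
  exact: (q0m _ (inclP (q1 (delta_mx 0 0)))).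
have coL : linear (fun x : 'rV[R]_b.+1 => x 0 0 : R^o) by move=> c x y; rewrite !mxE.
have K1m x : s * (lin_of coL \o incl (ker q1)) x = 0 by exact: q1m _ (inclP x) _.
pose pr := lin_of (retraction_linear K1m).
have pr_io t : pr (io t) = s * t by rewrite /= ioE /= !mxE eqxx mulr1 retraction_mul.
have io0 y t : s * y = 0 -> y *: io t = 0.
  move=> sy; apply: incl_inj; rewrite linearZ linear0 /= ioE /= scalerA.
  by rewrite mulrA (mulrC y) sy mul0r scale0r.
(* The correction term of the stable retraction vanishes on s R: m kills
   io t, hence the coordinates of u (io t) are not units and lie in m, while
   the values of pr are killed by m. *)
have vu0 t : pr (v (u (io t))) = 0.
  have um j : s * u (io t) 0 j = 0.
    apply: contrapT => /s_unit[z uz].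
    case: nfg; exists 0%N, (fun=> 0) => y; split=> [sy|[c ->]]; last by rewrite big_ord0 mulr0.
    exists (fun=> 0); rewrite big_ord0 -[y]mulr1 -uz mulrA.
    have /(congr1 (fun w : 'rV_m => w 0 j)) : u (y *: io t) = 0 by rewrite io0 ?linear0.
    by rewrite linearZ !mxE => ->; rewrite mul0r.
  rewrite -[LHS]/((pr \o v) (u (io t))) row_comb big1 // => j _ /=.
  have [c ->] := socle_im sr (K1m (v (delta_mx 0 j))).
  by rewrite -[_ *: _]/(_ * _) mulrA (mulrC _ s) um mul0r.
pose th' := pr \o r.
have th'i t : th' (i (io t)) = s * t.
  rewrite /th' -[LHS]/(pr (r (i (io t)))) -pr_io -[in RHS](iruv (io t)) linearD.
  by rewrite vu0 addr0.
have ims x : exists t, th' x = s * t by exact: (socle_im sr (K1m _)).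
pose sI := im (mulmap s).
have [x|th'' th''E] := @factor_inj _ _ _ _ (incl sI) (th' \o p2) (@incl_inj _ _ _).
  by apply: incl_surj; have [t tE] := ims (p2 x); exists t; exact: esym tE.
have [x|ms msE] := @factor_inj _ _ _ _ (incl sI) (mulmap s) (@incl_inj _ _ _).
  by apply: incl_surj; exists x.
have mss : surj ms.
  by move=> y; have [x xE] := inclP y; exists x; apply: incl_inj; rewrite msE.
(* [ta] lifts the composite F 2 -> s R along the multiplication R -> s R. *)
have [ta taE] := Fp 2%N isT _ _ ms th'' mss.
have {th'' th''E ms msE mss} {}taE x : s * ta x = th' (p2 x).
  by rewrite -[LHS]/(mulmap s (ta x)) -msE taE th''E.
(* [x0] lies over the generator of the summand s R, so w = ta x0 satisfies
   s w = s.  For y in m, y = y (1 - w) + ta (y x0), where y x0 is mapped to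
   y (i (io 1)) = 0 and comes from F 3.  Hence m is spanned by 1 - w together
   with the image of F 3. *)
have [x0 x0E] := p2s (i (io 1)).
have sw : s * ta x0 = s by rewrite taE x0E th'i mulr1.
pose I := ker (mulmap s).
apply: (@fin_gen_ideal R I).
have aL : linear (fun c : R^o => c * (1 - ta x0) : R^o).
  by move=> c x y; rewrite mulrDl -[c *: x]/(c * x) -mulrA.
have [c|al alE] := @factor_inj _ _ _ _ (incl I) (lin_of aL) (@incl_inj _ _ _).
  by apply: incl_surj; rewrite /= mulrCA mulrBr mulr1 sw subrr mulr0.
have [z|be beE] := @factor_inj _ _ _ _ (incl I) (ta \o d 2) (@incl_inj _ _ _).
  have p2z : p2 (d 2 z) = 0 by apply/p20/ex2; exists z.
  by apply: incl_surj; apply: etrans (taE _) _; rewrite p2z; exact: (linear0 th').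
apply: (@fin_gen_sum _ _ _ _ al be).
- move=> y; have sy : s * incl I y = 0 := inclP y.
  have yx0 : p2 (incl I y *: x0) = 0.
    have iZ : i (incl I y *: io 1) = incl I y *: i (io 1) by rewrite linearZ.
    by rewrite linearZ /= x0E -iZ io0 // linear0.
  have [z zE] := (ex2 _).1 ((p20 _).1 yx0).
  exists (incl I y), z; apply: incl_inj; rewrite linearD alE beE /= zE linearZ /=.
  by rewrite mulrBr mulr1 subrK.
- exact/fg_free_fin_gen/regular_fg_free.
- exact: Fg.
Qed.

End Socle.

(** * Modules over a product of rings *)

(** [R] is a direct factor of [T]: [fpr] is the projection and [finj] the section
whose value at 1 is the corresponding idempotent.  Both factors of a product
are instances. *)
Record ring_factor (T R : comPzRingType) := RingFactor {
  fpr : {rmorphism T -> R};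
  finj : R -> T;
  finjD : forall x y, finj (x + y) = finj x + finj y;
  finjM : forall x y, finj (x * y) = finj x * finj y;
  finjK : forall x, fpr (finj x) = x;
  fprK : forall t, finj (fpr t) = finj 1 * t }.

Section Factor.
Variables (T R : comPzRingType) (c : ring_factor T R).
Local Notation pi := (fpr c).
Local Notation sg := (finj c).
Local Notation e := (sg 1).

Lemma finj_idem r : e * sg r = sg r.
Proof. by rewrite -finjM mul1r. Qed.

Lemma fpr_idem : pi e = 1.
Proof. exact: finjK. Qed.

(** Restriction of scalars along the projection. *)
Definition res_type (N : lmodType R) : Type := N.
HB.instance Definition _ N := GRing.Zmodule.on (res_type N).

Section Res.
Variable N : lmodType R.
Definition res_scale (t : T) (x : res_type N) : res_type N := pi t *: (x : N).
Lemma res_scaleA a b x : res_scale a (res_scale b x) = res_scale (a * b) x.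
Proof. by rewrite /res_scale rmorphM scalerA. Qed.
Lemma res_scale1 : left_id 1 res_scale.
Proof. by move=> x; rewrite /res_scale rmorph1 scale1r. Qed.
Lemma res_scaleDr : right_distributive res_scale +%R.
Proof. by move=> a x y; rewrite /res_scale [LHS]scalerDr. Qed.
Lemma res_scaleDl x : {morph res_scale^~ x : a b / a + b}.
Proof. by move=> a b; rewrite /res_scale rmorphD [LHS]scalerDl. Qed.
HB.instance Definition _ := GRing.Zmodule_isLmodule.Build T (res_type N)
  res_scaleA res_scale1 res_scaleDr res_scaleDl.
End Res.

Definition res (N : lmodType R) : lmodType T := res_type N.

Lemma resZ (N : lmodType R) t (x : res N) : t *: x = (pi t *: (x : N) : N).
Proof. by []. Qed.

Lemma res_map_linear (U V : lmodType R) (f : {linear U -> V}) :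
  linear (f : res U -> res V).
Proof. by move=> a x y; rewrite resZ linearP. Qed.
Definition res_map (U V : lmodType R) (f : {linear U -> V}) : {linear res U -> res V} :=
  lin_of (res_map_linear f).

Lemma fixed_closed (N : lmodType T) : submodule_closed (fun x : N => e *: x = x).
Proof.
split; first exact: scaler0.
- by move=> x y ex ey; rewrite scalerDr ex ey.
- by move=> a x ex; rewrite scalerA mulrC -scalerA ex.
Qed.
Definition fixed N := Submodule (fixed_closed N).

(** The part e N of a T-module N, where e is the idempotent of the factor; it is
both left and right adjoint to [res], see [corner_lift] and
[corner_extend]. *)
Definition corner_type (N : lmodType T) : Type := subof (fixed N).
HB.instance Definition _ N := GRing.Zmodule.on (corner_type N).

Section Corner.
Variable N : lmodType T.
Definition corner_scale (r : R) (x : corner_type N) : corner_type N :=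
  sg r *: (x : subof (fixed N)).
Lemma corner_scaleA a b x : corner_scale a (corner_scale b x) = corner_scale (a * b) x.
Proof. by rewrite /corner_scale finjM scalerA. Qed.
Lemma corner_scale1 : left_id 1 corner_scale.
Proof.
by move=> x; apply: (@incl_inj _ _ (fixed N)); rewrite [LHS]linearZ; exact: (inclP x).
Qed.
Lemma corner_scaleDr : right_distributive corner_scale +%R.
Proof. by move=> a x y; rewrite /corner_scale [LHS]scalerDr. Qed.
Lemma corner_scaleDl x : {morph corner_scale^~ x : a b / a + b}.
Proof. by move=> a b; rewrite /corner_scale finjD [LHS]scalerDl. Qed.
HB.instance Definition _ := GRing.Zmodule_isLmodule.Build R (corner_type N)
  corner_scaleA corner_scale1 corner_scaleDr corner_scaleDl.
End Corner.

Definition corner (N : lmodType T) : lmodType R := corner_type N.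

Section CornerTheory.
Variable N : lmodType T.

Lemma cincl_subproof : {f : {linear res (corner N) -> N} |
  [/\ injective f, forall x, e *: f x = f x,
      forall (r : R) (x : corner N), f (r *: x) = sg r *: f x &
      forall x, e *: x = x -> exists y, f y = x]}.
Proof.
pose f (x : res (corner N)) : N := incl (fixed N) x.
have fe x : e *: f x = f x := inclP x.
have fZ r (x : corner N) : f (r *: x) = sg r *: f x by rewrite /f [LHS]linearZ.
have fL : linear f.
  move=> a x y; rewrite resZ /f [LHS]linearD -!/(f _) fZ fprK mulrC -scalerA.
  by rewrite fe.
exists (lin_of fL); split=> // [|x]; first exact: incl_inj.
exact: (@incl_surj _ _ (fixed N)).
Qed.
Definition cincl : {linear res (corner N) -> N} := sval cincl_subproof.
Lemma cincl_inj : injective cincl.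
Proof. by have [] := svalP cincl_subproof. Qed.
Lemma cincl_fixed x : e *: cincl x = cincl x.
Proof. by have [] := svalP cincl_subproof. Qed.
Lemma cinclZ (r : R) (x : corner N) : cincl (r *: x) = sg r *: cincl x.
Proof. by have [] := svalP cincl_subproof. Qed.

Lemma cincl_surj x : e *: x = x -> exists y, cincl y = x.
Proof. by have [_ _ _] := svalP cincl_subproof; apply. Qed.

Lemma cproj_subproof : {f : {linear N -> res (corner N)} |
  forall x, cincl (f x) = e *: x}.
Proof.
apply: cid.
have L : linear (fun x : N => e *: x).
  by move=> a x y; rewrite scalerDr !scalerA mulrC.
apply: (@factor_inj T (res (corner N)) N N cincl (lin_of L) cincl_inj) => x.
by apply: cincl_surj; rewrite /= scalerA finj_idem.
Qed.
Definition cproj : {linear N -> res (corner N)} := sval cproj_subproof.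
Lemma cprojE x : cincl (cproj x) = e *: x.
Proof. exact: (svalP cproj_subproof x). Qed.
Lemma cproj_cincl x : cproj (cincl x) = x.
Proof. by apply: cincl_inj; rewrite cprojE cincl_fixed. Qed.
End CornerTheory.
Arguments cincl {N}.
Arguments cincl_inj {N} [x1 x2].
Arguments cincl_fixed {N}.
Arguments cinclZ {N}.
Arguments cincl_surj {N x}.
Arguments cproj {N}.
Arguments cprojE {N}.
Arguments cproj_cincl {N}.

Lemma corner_lift (P : lmodType R) (V : lmodType T) (f : {linear res P -> V}) :
  exists g : {linear P -> corner V}, forall x, cincl (g x) = f x.
Proof.
have fe x : e *: f x = f x by rewrite -linearZ /= resZ fpr_idem scale1r.
have /choice[g gE] x := cincl_surj (fe x).
have gL : linear (g : P -> corner V).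
  move=> a x y; apply: cincl_inj; rewrite linearD cinclZ !gE.
  rewrite [f _]linearD; congr (_ + _).
  by rewrite -[RHS]linearZ /= resZ finjK.
by exists (lin_of gL).
Qed.

Lemma corner_extend (P : lmodType R) (V : lmodType T) (f : {linear V -> res P}) :
  exists g : {linear corner V -> P}, forall x, g x = f (cincl x).
Proof.
have gL : linear (fun x : corner V => f (cincl x) : P).
  move=> a x y; rewrite [f _](_ : _ = f (sg a *: cincl x + cincl y)).
    by rewrite linearP resZ finjK.
  by rewrite -cinclZ -[RHS](congr1 f (linearD (@cincl V) _ _)).
by exists (lin_of gL).
Qed.

Lemma corner_map_subproof (U V : lmodType T) (f : {linear U -> V}) :
  {g : {linear corner U -> corner V} | forall x, cincl (g x) = f (cincl x)}.
Proof. exact/cid/(corner_lift (f \o @cincl U)). Qed.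
Definition corner_map (U V : lmodType T) (f : {linear U -> V}) :
  {linear corner U -> corner V} := sval (corner_map_subproof f).
Lemma corner_mapE (U V : lmodType T) (f : {linear U -> V}) x :
  cincl (corner_map f x) = f (cincl x).
Proof. exact: (svalP (corner_map_subproof f) x). Qed.

Lemma cincl_corner0 (V : lmodType T) : cincl (0 : corner V) = 0.
Proof. exact: (linear0 (@cincl V)). Qed.

Lemma corner_map_surj (U V : lmodType T) (f : {linear U -> V}) :
  surj f -> surj (corner_map f).
Proof.
move=> fs y; have [x xE] := fs (cincl y).
exists (cproj x); apply: cincl_inj.
by rewrite corner_mapE cprojE linearZ /= xE cincl_fixed.
Qed.

Lemma corner_exact (U V W : lmodType T) (f : {linear U -> V}) (g : {linear V -> W}) :
  exact_at f g -> exact_at (corner_map f) (corner_map g).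
Proof.
move=> fg v; split=> [gv|[u <-]].
  have /fg[u uE] : g (cincl v) = 0 by rewrite -corner_mapE gv cincl_corner0.
  exists (cproj u); apply: cincl_inj.
  by rewrite corner_mapE cprojE linearZ /= uE cincl_fixed.
apply: cincl_inj; rewrite !corner_mapE cincl_corner0.
exact: exact_comp0.
Qed.

Lemma corner_ses (K G N : lmodType T) (i : {linear K -> G}) (p : {linear G -> N}) :
  ses i p -> ses (corner_map i) (corner_map p).
Proof.
move=> [ii ps ip]; split; [|exact: corner_map_surj|exact: corner_exact].
by move=> x y /(congr1 (@cincl G)); rewrite !corner_mapE => /ii/cincl_inj.
Qed.

Lemma res_iso (U V : lmodType R) : iso U V -> iso (res U) (res V).
Proof. by move=> [f [fi fs]]; exists (res_map f). Qed.

Lemma corner_iso (U V : lmodType T) : iso U V -> iso (corner U) (corner V).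
Proof.
move=> [f [fi fs]]; exists (corner_map f); split; last exact: corner_map_surj.
by move=> x y /(congr1 (@cincl V)); rewrite !corner_mapE => /fi/cincl_inj.
Qed.

Lemma corner_res (N : lmodType R) : iso (corner (res N)) N.
Proof.
have [g gE] := corner_extend (idfun : {linear res N -> res N}).
exists g; split=> [x y|y]; first by rewrite !gE => exy; exact: (@cincl_inj (res N) x y exy).
have [|x xE] := @cincl_surj (res N) y; first by rewrite resZ fpr_idem scale1r.
by exists x; rewrite gE.
Qed.

(** Restriction and corner are exact and adjoint to each other on both sides, so
each of them preserves projectives, chains and Gorenstein projective
dimension. *)
Lemma res_projective (P : lmodType R) : projective P -> projective (res P).
Proof.
move=> Pp U V g f gs; have [f' f'E] := corner_lift f.
have [h hE] := Pp _ _ (corner_map g) f' (corner_map_surj gs).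
exists (@cincl U \o res_map h) => x.
by rewrite /= -corner_mapE hE f'E.
Qed.

Lemma corner_projective (Q : lmodType T) : projective Q -> projective (corner Q).
Proof.
move=> Qp U V g f gs.
have [h hE] := Qp _ _ (res_map g) (res_map f \o @cproj Q) gs.
have [h' h'E] := corner_extend h; exists h' => x; rewrite h'E.
by have := hE (cincl x); rewrite /= cproj_cincl.
Qed.

Lemma res_link (X Y : lmodType R) : link X Y -> link (res X) (res Y).
Proof.
move=> [P [i [p [Pp s ext]]]]; exists (res P), (res_map i), (res_map p); split=> //.
  exact: res_projective.
move=> Q Qp phi; have [phi' phi'E] := corner_lift phi.
have [psi psiE] := ext _ (corner_projective Qp) phi'.
exists (@cincl Q \o res_map psi) => x.
by rewrite /= psiE phi'E.
Qed.

Lemma corner_link (X Y : lmodType T) : link X Y -> link (corner X) (corner Y).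
Proof.
move=> [P [i [p [Pp s ext]]]].
exists (corner P), (corner_map i), (corner_map p); split.
- exact: corner_projective.
- exact: corner_ses.
- move=> Q Qp phi.
  have [psi psiE] := ext _ (res_projective Qp) (res_map phi \o @cproj X).
  have [psi' psi'E] := corner_extend psi; exists psi' => x.
  by rewrite psi'E corner_mapE psiE /= cproj_cincl.
Qed.

Lemma res_gproj (N : lmodType R) :
  gorenstein_projective N -> gorenstein_projective (res N).
Proof.
move=> /chain_of_gproj[K LK NK].
apply: (@gproj_of_chain _ _ (fun i => res (K i))); last exact: res_iso.
by move=> i; exact: res_link.
Qed.

Lemma corner_gproj (N : lmodType T) :
  gorenstein_projective N -> gorenstein_projective (corner N).
Proof.
move=> /chain_of_gproj[K LK NK].
apply: (@gproj_of_chain _ _ (fun i => corner (K i))); last exact: corner_iso.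
by move=> i; exact: corner_link.
Qed.

Lemma res_gdim m (N : lmodType R) : gdim_le m N -> gdim_le m (res N).
Proof.
elim: m N => [|m IH] N; first exact: res_gproj.
move=> [K [G [i [p [Gp s Km]]]]].
exists (res K), (res G), (res_map i), (res_map p); split=> //.
- exact: res_gproj.
- exact: IH.
Qed.

Lemma corner_gdim m (N : lmodType T) : gdim_le m N -> gdim_le m (corner N).
Proof.
elim: m N => [|m IH] N; first exact: corner_gproj.
move=> [K [G [i [p [Gp s Km]]]]].
exists (corner K), (corner G), (corner_map i), (corner_map p); split.
- exact: corner_gproj.
- exact: corner_ses.
- exact: IH.
Qed.

Lemma corner_row n :
  iso ('rV[R]_n : lmodType R) (corner ('rV[T]_n : lmodType T)).
Proof.
have iP (x : 'rV[R]_n) : e *: (map_mx sg x : 'rV[T]_n) = map_mx sg x.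
  by apply/rowP => j; rewrite !mxE finj_idem.
have /choice[g gE] x := cincl_surj (iP x).
have gL : linear (g : 'rV[R]_n -> corner ('rV[T]_n : lmodType T)).
  move=> a x y; apply: cincl_inj; rewrite linearD cinclZ !gE.
  by apply/rowP => j; rewrite !mxE finjD finjM.
exists (lin_of gL); split=> [x y|y].
  move=> /(congr1 (@cincl _)); rewrite /= !gE => /rowP exy.
  apply/rowP => j; rewrite -[x 0 j](finjK c) -[y 0 j](finjK c).
  by congr (pi _); have := exy j; rewrite !mxE.
exists (map_mx pi (cincl y)); apply: cincl_inj; rewrite /= gE -[RHS]cincl_fixed.
by apply/rowP => j; rewrite !mxE fprK.
Qed.

Lemma corner_fg_free (F : lmodType T) : fg_free F -> fg_free (corner F).
Proof.
move=> /fg_free_iso[n /corner_iso i]; apply: (@iso_fg_free _ n).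
exact: iso_trans (corner_row n) i.
Qed.

Lemma corner_n_presented n (N : lmodType T) :
  n_presented n N -> n_presented n (corner N).
Proof.
move=> [F [d [eps [Ff es e0 eS]]]].
exists (fun i => corner (F i)), (fun i => corner_map (d i)), (corner_map eps).
split=> [i /Ff/corner_fg_free //||/e0|i /eS].
- exact: corner_map_surj.
- exact: corner_exact.
- exact: corner_exact.
Qed.

Lemma res_fin_gen (N : lmodType R) : fin_gen N -> fin_gen (res N).
Proof.
move=> [n [q qs]].
exists n, (comb (fun j => q (delta_mx 0 j) : res N)) => y.
have [x <-] := qs y; exists (map_mx sg x).
rewrite /= (row_comb q); apply: eq_bigr => j _.
by rewrite mxE resZ finjK.
Qed.

End Factor.
Arguments cincl {T R} c {N}.
Arguments cincl_inj {T R} c {N} [x1 x2].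
Arguments cincl_fixed {T R} c {N}.
Arguments cproj {T R} c {N}.
Arguments cprojE {T R} c {N}.

(** * The product with a Noetherian ring *)
Section Noetherian.
Variable S : comPzRingType.
Hypothesis Sn : noetherian S.

Lemma submodule_ideal (I : submodule S^o) : is_ideal I.
Proof. exact: smemP. Qed.

(** Induction on n: the first coordinates form an ideal, which is finitely
generated, and the kernel of the first coordinate embeds in S^(n-1). *)
Lemma noetherian_fin_gen n (V : lmodType S) (i : {linear V -> 'rV[S]_n}) :
  injective i -> fin_gen V.
Proof.
elim: n V i => [|n IH] V i ii.
  exists 0%N, (zero_map _ _) => x; exists 0; apply: ii.
  by apply/rowP => -[].
have pL : linear (fun x => i x 0 0 : S^o) by move=> a x y; rewrite linearP !mxE.
have [p pE] : {p : {linear V -> S^o} | forall x, p x = i x 0 0}.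
  by exists (lin_of pL).
have [m [g gP]] := Sn (submodule_ideal (im p)).
have /choice[v vE] j : exists v, p v = g j.
  apply/(gP (g j)); exists (fun k => (k == j)%:R).
  rewrite (bigD1 j) //= eqxx mul1r big1 ?addr0 // => k /negPf ->.
  by rewrite mul0r.
have qL : linear (fun x : subof (ker p) => \row_j i (incl (ker p) x) 0 (lift 0 j)).
  by move=> a x y; apply/rowP => j; rewrite !linearP !mxE.
have kg : fin_gen (subof (ker p)).
  apply: (IH _ (lin_of qL)); apply: lin_inj => x qx; apply: incl_inj; apply: ii.
  rewrite !linear0; apply/rowP => j; rewrite mxE.
  case: (unliftP 0 j) => [k ->|->]; last by rewrite -pE (inclP x : p _ = 0).
  by have /rowP/(_ k) := qx; rewrite !mxE.
apply: (@fin_gen_sum _ _ _ _ (comb v) (incl (ker p))) kg.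
  move=> w; have /gP[c cE] : im p (p w) by exists w.
  have [|y yE] := @incl_surj _ _ (ker p) (w - comb v (\row_j c j)).
    apply/eqP; rewrite linearB subr_eq0; apply/eqP; rewrite cE.
    rewrite /= linear_sum; apply: eq_bigr => j _.
    by rewrite linearZ /= vE mxE.
  by exists (\row_j c j), y; rewrite yE addrC subrK.
exact/fg_free_fin_gen/row_fg_free.
Qed.

End Noetherian.

Section Product.
Variables R S : comPzRingType.
Local Notation T := (R * S)%type.

Lemma fst_fprK (t : T) : (t.1, 0) = (1, 0) * t :> T.
Proof. by case: t => x y; congr pair; rewrite /= ?mul1r ?mul0r. Qed.
Lemma snd_fprK (t : T) : (0, t.2) = (0, 1) * t :> T.
Proof. by case: t => x y; congr pair; rewrite /= ?mul1r ?mul0r. Qed.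

Lemma fst_finjD (x y : R) : (x + y, 0) = (x, 0) + (y, 0) :> T.
Proof. by congr pair; rewrite /= addr0. Qed.
Lemma fst_finjM (x y : R) : (x * y, 0) = (x, 0) * (y, 0) :> T.
Proof. by congr pair; rewrite /= mulr0. Qed.
Lemma snd_finjD (x y : S) : (0, x + y) = (0, x) + (0, y) :> T.
Proof. by congr pair; rewrite /= addr0. Qed.
Lemma snd_finjM (x y : S) : (0, x * y) = (0, x) * (0, y) :> T.
Proof. by congr pair; rewrite /= mulr0. Qed.

Definition fst_factor : ring_factor T R :=
  @RingFactor T R fst (fun x => (x, 0)) fst_finjD fst_finjM (fun=> erefl) fst_fprK.
Definition snd_factor : ring_factor T S :=
  @RingFactor T S snd (fun x => (0, x)) snd_finjD snd_finjM (fun=> erefl) snd_fprK.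

Local Notation c1 := fst_factor.
Local Notation c2 := snd_factor.

Lemma factor_add (N : lmodType T) (x : N) :
  finj c1 1 *: x + finj c2 1 *: x = x.
Proof.
rewrite -scalerDl (_ : _ + _ = 1) ?scale1r //.
by congr pair; rewrite /= ?addr0 ?add0r.
Qed.

Lemma product_decomposition (N : lmodType T) :
  iso (res c2 (corner c2 N) * res c1 (corner c1 N))%type N.
Proof.
pose X : lmodType T := (res c2 (corner c2 N) * res c1 (corner c1 N))%type.
have fL : linear (fun x : X => cincl c2 x.1 + cincl c1 x.2).
  by move=> a x y; rewrite !linearP scalerDr addrACA.
exists (lin_of fL); split.
  apply: lin_inj => -[x y] /= xy0.
  have e12 : finj c1 1 * finj c2 1 = 0 by congr pair; rewrite /= ?mulr0 ?mul0r.
  have y0 : cincl c1 y = 0.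
    have := congr1 (fun z => finj c1 1 *: z) xy0.
    rewrite scaler0 scalerDr -(cincl_fixed c2 x) scalerA e12 scale0r add0r.
    by rewrite cincl_fixed.
  move: xy0; rewrite y0 addr0 => x0; congr pair.
    by apply: (cincl_inj c2); rewrite x0 linear0.
  by apply: (cincl_inj c1); rewrite y0 linear0.
by move=> x; exists (cproj c2 x, cproj c1 x); rewrite /= !cprojE addrC factor_add.
Qed.

Lemma product_G_ring_3 (d : int) :
  (forall N : lmodType R, n_presented 3 N -> projective N) ->
  (forall N : lmodType S, Gpd_le N d) -> G_ring T 3 d.
Proof.
move=> HR HS N N3; apply/Gpd_leP.
have /Gpd_leP[m [md Nm]] := HS (corner c2 N).
exists m; split=> //; apply: gdim_iso (product_decomposition N) _.
apply: gdim_pair_projective; first exact: res_gdim.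
exact/res_projective/HR/corner_n_presented.
Qed.

(** S itself is not free over T, but it is finitely generated and its R-part is
zero.  For a finitely generated module whose R-part is projective, stated as:
the idempotent of [R] acts through a free module, the kernel of any free cover
has the same property.  Such modules are thus n-presented for every n. *)
Definition fg_fst_stably_free (X : lmodType T) : Prop :=
  fin_gen X /\ exists (a : nat) (u : {linear X -> 'rV[T]_a})
    (v : {linear 'rV[T]_a -> X}), forall x, v (u x) = finj c1 1 *: x.

(** On the kernel, the idempotent of [R] is the restriction of
h = e (1 - w u p), where w lifts v; so it factors through the free cover, and
the R-part of the kernel is finitely generated.  Its S-part embeds in S^r. *)
Lemma fg_fst_stably_free_ker r (X : lmodType T) (p : {linear 'rV[T]_r -> X}) :
  noetherian S -> surj p -> fg_fst_stably_free X -> fg_fst_stably_free (subof (ker p)).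
Proof.
move=> Sn ps [_ [a [u [v uv]]]].
have [w wE] := @row_projective T a _ _ p v ps.
have hL : linear (fun x => finj c1 1 *: (x - w (u (p x)))).
  have h0L : linear (fun x => x - w (u (p x))).
    by move=> b x y; rewrite !linearP scalerDr addrACA.
  by move=> b x y; rewrite h0L scalerDr !scalerA (mulrC b).
have [x|h hE] := @factor_inj _ _ _ _ (incl (ker p)) (lin_of hL) (@incl_inj _ _ _).
  apply: incl_surj; rewrite /= linearZ linearB /= wE uv scalerBr scalerA.
  by rewrite (finj_idem c1) subrr.
have hincl k : h (incl (ker p) k) = finj c1 1 *: k.
  by apply: incl_inj; rewrite hE linearZ /= (inclP k : p _ = 0) !linear0 addr0.
split; last by exists r, (incl (ker p)), h.
pose K2 := corner c2 (subof (ker p)).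
have [f [fi _]] := iso_sym (corner_row c2 r).
have K2g : fin_gen K2.
  apply: (@noetherian_fin_gen S Sn r K2 (f \o corner_map c2 (incl (ker p)))).
  move=> x y /fi/(congr1 (cincl c2)); rewrite !corner_mapE => /incl_inj.
  exact: (cincl_inj c2).
apply: (@fin_gen_sum _ _ _ _ h (cincl c2)); last exact: res_fin_gen.
  move=> k; exists (incl (ker p) k), (cproj c2 k).
  by rewrite hincl cprojE factor_add.
exact/fg_free_fin_gen/row_fg_free.
Qed.

Lemma fg_fst_stably_free_presented n (X : lmodType T) :
  noetherian S -> fg_fst_stably_free X -> n_presented n X.
Proof.
move=> Sn; elim: n X => [|n IH] X Xa; have [[r [p ps]] _] := Xa.
  exists (fun=> 'rV[T]_r : lmodType T), (fun=> zero_map _ _), p; split=> // i _.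
  exact: row_fg_free.
have [F [d [eps [Ff es e0 eS]]]] := IH _ (fg_fst_stably_free_ker Sn ps Xa).
pose F' j : lmodType T := if j is j'.+1 then F j' else 'rV[T]_r.
pose d' j : {linear F' j.+1 -> F' j} :=
  match j return {linear F' j.+1 -> F' j} with
  | 0 => incl (ker p) \o eps | j'.+1 => d j' end.
exists F', d', p; split=> //.
- by case=> [_|j jn]; [exact: row_fg_free|exact: Ff].
- move=> _ v; split=> [pv|[x <-]]; last exact: (inclP (eps x)).
  have [y <-] := @incl_surj _ _ (ker p) v pv.
  by have [x <-] := es y; exists x.
- case=> [n0|j jn]; last exact: eS.
  move=> v; rewrite -(e0 n0) /=; split=> [ev|->]; last exact: linear0.
  by apply: incl_inj; rewrite ev linear0.
Qed.

(** A module that is zero over [R] and cyclic over [S] is 3-presented over T, so a bound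
d - 1 over T bounds the dimension of all cyclic S-modules. *)
Lemma product_not_G_ring_3 (d : nat) : noetherian S -> G_gldim_eq S d ->
  ~ G_ring T 3 (d%:Z - 1).
Proof.
move=> Sn [Sd dmin] GT.
have cyc (I : submodule S^o) : exists2 m : nat, m%:Z <= d%:Z - 1 & gdim_le m (quotof I).
  have Xa : fg_fst_stably_free (res c2 (quotof I)).
    split.
      apply: res_fin_gen; apply: (fin_gen_image (@proj_surj _ _ I)).
      exact/fg_free_fin_gen/regular_fg_free.
    exists 0%N, (zero_map _ _), (zero_map _ _) => x.
    by rewrite resZ /= scale0r.
  have /GT/Gpd_leP[m [md Xm]] := fg_fst_stably_free_presented 3 Sn Xa.
  exists m => //; apply: gdim_iso (corner_res c2 (quotof I)) _.
  exact: corner_gdim.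
have [m0 m0d _] := cyc (ker (zero_map S^o S^o)).
case: d => [|d] in Sd dmin GT cyc m0d *; first by case: m0 m0d.
have Sfin (N : lmodType S) : exists m, gdim_le m N.
  by have /Gpd_leP[m [_ Nm]] := Sd N; exists m.
have /dmin : forall N : lmodType S, Gpd_le N d.
  move=> N; apply/Gpd_leP; exists d; split=> //; apply: gdim_from_cyclic => // I.
  have [m md Im] := cyc I; exists m => //.
  by move: md; rewrite -addn1 PoszD addrK lez_nat.
by rewrite ltnn.
Qed.

Lemma product_socle s rho : socle_retraction s rho ->
  @socle_retraction T (s, 0) (fun x => (rho x.1, 0)).
Proof.
move=> [s2 rD rM rI rid].
have s1 (x : T) : (s, 0) * x = 0 -> s * x.1 = 0 by case.
split.
- by congr pair; rewrite /= ?mulr0.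
- by move=> x y /s1 sx /s1 sy; congr pair; rewrite /= ?addr0 // rD.
- by move=> a x /s1 sx; congr pair; rewrite /= ?mulr0 // rM.
- move=> x /s1/rI[t tE]; exists (t, 0); congr pair; by rewrite /= ?mulr0.
- by rewrite /= rid.
Qed.

Lemma product_not_G_ring_2 s rho b (d : nat) : socle_retraction s rho ->
  (forall x : R, b * x = 0 <-> exists t, x = s * t) ->
  (forall t : R, ~ forall x, s * x = 0 -> rho x = t * x) ->
  ~ G_ring T 2 d.
Proof.
move=> sr bs nrho; apply: (not_G_ring_2 (product_socle sr) (b := (b, 1))).
  move=> [x y]; split=> [[/bs[t ->]]|[[t u] [-> ->]]].
    by rewrite mul1r => ->; exists (t, 0); congr pair; rewrite /= mul0r.
  by congr pair; rewrite /= ?mul0r ?mulr0 //; apply/bs; exists t.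
move=> [t u] H; apply: (nrho t) => x sx.
have /H[] : (s, 0) * (x, 0) = 0 :> T by congr pair; rewrite /= ?mulr0.
by [].
Qed.

End Product.

(** * The trivial extension of a local ring by its residue field *)
Section TrivialExtension.
Variables (A : comNzRingType) (M : idealr A).
Local Notation k := {ideal_quot M}.
Local Notation R := (trivial_ext k).
Local Notation pik := (\pi_{ideal_quot M}).

Lemma pi_eq0 a : pik a = 0 <-> a \in M.
Proof.
rewrite -[0](rmorph0 pik); split=> [/eqP|aM]; last apply/eqP.
  by rewrite -Quotient.idealrBE subr0.
by rewrite -Quotient.idealrBE subr0.
Qed.

(** A non-unit generates a proper ideal, contained in a maximal one by Zorn's
lemma, and [M] is the only maximal ideal. *)
Lemma local_unit : local_ring M -> forall a, a \notin M -> exists b, a * b = 1.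
Proof.
move=> [Mmax Muniq] a aM; apply: contrapT => nu.
have [_ [b <-] ab1|J [aJ J1 Jmax]] :=
    @zorn_submodule A A^o (im (mulmap a)) (fun x => x <> 1).
  by apply: nu; exists b.
have Jm : is_maximal_ideal J.
  split; [exact: smemP|by move/J1|move=> J' J'I J'1 JJ'].
  apply: (Jmax (@Submodule A A^o J' J'I)) => // x J'x x1.
  by apply: J'1; rewrite -x1.
have /aJ/(Muniq J Jm) aM' : im (mulmap a) a by exists 1; exact: mulr1.
by rewrite aM' in aM.
Qed.

Definition socle_gen : R := (0, 1).
Definition socle_proj (x : R) : R := (0, x.2).

Lemma socle_genE (x : R) : socle_gen * x = (0, pik x.1).
Proof.
by case: x => a f; congr pair; rewrite /= ?mul0r // scale0r add0r; exact: mulr1.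
Qed.

Lemma socle_gen_eq0 (x : R) : socle_gen * x = 0 <-> x.1 \in M.
Proof. by rewrite socle_genE -pi_eq0; split=> [[]|->]. Qed.

Lemma socle_genP (g : k) : exists t, (0, g) = socle_gen * t :> R.
Proof. by exists (repr g, 0); rewrite socle_genE /= reprK. Qed.

Lemma trivial_ext_socle : socle_retraction socle_gen socle_proj.
Proof.
split.
- by apply/socle_gen_eq0; rewrite rpred0.
- by move=> x y _ _; congr pair; rewrite /= addr0.
- move=> a x /socle_gen_eq0/pi_eq0 xM; congr pair; rewrite /= ?mulr0 // scale0r addr0.
  by rewrite [x.1 *: _](_ : _ = 0) ?addr0 //; rewrite /GRing.scale /= /quot_scale xM mul0r.
- by move=> x _; exact: socle_genP.
- by [].
Qed.

(** The inverse of (a, f) is (b, - b ^ 2 f) with b the inverse of a. *)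
Lemma trivial_ext_unit : local_ring M ->
  forall x : R, socle_gen * x <> 0 -> exists y, x * y = 1.
Proof.
move=> loc [a f] sx; have /(local_unit loc)[b ab] : a \notin M.
  by apply/negP => aM; apply: sx; apply/socle_gen_eq0.
exists (b, - (b * b) *: f); congr pair => //=.
by rewrite scalerA mulrN mulrA ab mul1r scaleNr addNr.
Qed.

Lemma trivial_ext_not_fg : ~ fg_ideal (fun x : A => x \in M) ->
  ~ fg_ideal (fun x : R => socle_gen * x = 0).
Proof.
move=> nfg [n [g gP]]; apply: nfg; exists n, (fun i => (g i).1) => x.
have sum1 (F : 'I_n -> R) : (\sum_i F i).1 = \sum_i (F i).1.
  by apply: (big_morph (@fst A k)).
split=> [xM|[c ->]].
  have /gP[c cE] : socle_gen * (x, 0) = 0 by apply/socle_gen_eq0.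
  by exists (fun i => (c i).1); rewrite -[x]/((x, 0) : R).1 cE sum1.
have /socle_gen_eq0 : socle_gen * (\sum_i ((c i, 0) : R) * g i) = 0 by apply/gP; exists (fun i => (c i, 0) : R).
by rewrite sum1 (eq_bigr (fun i => c i * (g i).1)).
Qed.

Lemma trivial_ext_regular a : a \in M -> GRing.lreg a ->
  (forall x : R, ((a, 0) : R) * x = 0 <-> exists t, x = socle_gen * t) /\
  (forall t : R, ~ forall x, socle_gen * x = 0 -> socle_proj x = t * x).
Proof.
move=> aM areg.
have a0 (b : A) : a * b = 0 -> b = 0 by move=> ab; apply: areg; rewrite mulr0.
have as0 (g : k) : a *: g = 0.
  by rewrite /GRing.scale /= /quot_scale (pi_eq0 a).2 // mul0r.
split.
  move=> [b g]; split=> [[/a0 -> _]|[t ->]]; first exact: socle_genP.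
  by rewrite socle_genE; congr pair; rewrite /= ?mulr0 // as0 scaler0 addr0.
move=> [b g] H.
have b0 : b = 0.
  have /H[] : socle_gen * (a, 0) = 0 by apply/socle_gen_eq0.
  by rewrite mulrC => /esym/a0.
have /H[] : socle_gen * socle_gen = 0 := socle_sq0 trivial_ext_socle.
rewrite b0 !scale0r addr0 => _ /eqP; exact/negP/oner_neq0.
Qed.

End TrivialExtension.

Theorem theorem3p3 (A : comNzRingType) (M : idealr A) :
  local_ring M ->
  let R : comPzRingType := trivial_ext {ideal_quot M} in
  [/\
      ~ fg_ideal (fun x : A => x \in M) -> G_ring R 3 0,
      (exists2 a : A, a \in M & GRing.lreg a) ->
        forall d : nat, ~ G_ring R 2 d
    &
      ~ fg_ideal (fun x : A => x \in M) ->
      (exists2 a : A, a \in M & GRing.lreg a) ->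
      forall (S : comPzRingType) (d : nat),
        noetherian S -> G_gldim_eq S d ->
        let T : comPzRingType := (R * S)%type in
        [/\ G_ring T 3 d, ~ G_ring T 2 d & ~ G_ring T 3 (d%:Z - 1)]].
Proof.
move=> loc R.
have R3 : ~ fg_ideal (fun x : A => x \in M) ->
    forall N : lmodType R, n_presented 3 N -> projective N.
  move=> nfg N; apply: (three_presented_projective (trivial_ext_socle M) (trivial_ext_unit loc)).
  exact: trivial_ext_not_fg.
split.
- move=> nfg N /(R3 nfg) Np; apply/Gpd_leP; exists 0%N; split=> //.
  exact: projective_gproj.
- move=> [a aM areg]; have [bs nrho] := trivial_ext_regular aM areg.
  exact: (not_G_ring_2 (trivial_ext_socle M) bs nrho).
- move=> nfg [a aM areg] S d Sn Sd T; have [bs nrho] := trivial_ext_regular aM areg.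
  split.
  + by apply: product_G_ring_3; [exact: R3|case: Sd].
  + exact: (product_not_G_ring_2 (trivial_ext_socle M) bs nrho).
  + exact: product_not_G_ring_3.
Qed.
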